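(* Let $(H,\alpha)$ be a monoidal Hom-Hopf algebra and let $(A,\beta)$ be a monoidal Hom-algebra in the Hom-Yetter-Drinfeld category ${}^{H}_{H}\mathcal{HYD}$. Assume that the braiding $C$ is symmetric on $A$. Then the triple $(A,[\,,],\beta)$ is a braided Hom-Lie algebra, where the bracket product is defined by $$[\,,]:A\otimes A\to A,\qquad [a,b]=ab-(a_{(-1)}\cdot\beta^{-1}(b))\,\beta(a_{0})\qquad\text{for all }a,b\in A.$$
   Context: Everything is over a field $k$; Sweedler-type notation (summation suppressed) is used. Basic objects are pairs $(X,\alpha_X)$ of a $k$-vector space and a linear automorphism; morphisms are linear maps commuting with the automorphisms; $(X,\alpha_X)\otimes(Y,\alpha_Y)=(X\otimes Y,\alpha_X\otimes\alpha_Y)$, with associativity constraint $(x\otimes y)\otimes z\mapsto\alpha_X(x)\otimes(y\otimes\alpha_Z^{-1}(z))$ and unit object $(k,\mathrm{id})$. Monoidal Hom-algebra $(A,\beta)$: a pair with a multiplication and $1_A\in A$ such that $\beta(a)(bc)=(ab)\beta(c)$, $\beta(ab)=\beta(a)\beta(b)$, $a1_A=1_Aa=\beta(a)$, $\beta(1_A)=1_A$. Monoidal Hom-coalgebra $(C,\gamma)$: a pair with $\Delta(c)=c_1\otimes c_2$ and $\epsilon$ such that $\gamma^{-1}(c_1)\otimes\Delta(c_2)=\Delta(c_1)\otimes\gamma^{-1}(c_2)$, $\Delta(\gamma(c))=\gamma(c_1)\otimes\gamma(c_2)$, $c_1\epsilon(c_2)=\epsilon(c_1)c_2=\gamma^{-1}(c)$,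 $\epsilon(\gamma(c))=\epsilon(c)$. Monoidal Hom-Hopf algebra $(H,\alpha)$: both structures (with the same $\alpha$), $\Delta$ and $\epsilon$ multiplicative and unital, and an antipode $S$ with $S\alpha=\alpha S$, $S(h_1)h_2=\epsilon(h)1_H=h_1S(h_2)$. $S$ is assumed bijective with inverse $S^{-1}$. An object $(M,\mu)$ of ${}^{H}_{H}\mathcal{HYD}$ (left-left Hom-Yetter-Drinfeld module) is a pair with a left action satisfying $\alpha(h)\cdot(g\cdot m)=(hg)\cdot\mu(m)$, $1_H\cdot m=\mu(m)$, $\mu(h\cdot m)=\alpha(h)\cdot\mu(m)$, and a left coaction $\rho(m)=m_{(-1)}\otimes m_0\in H\otimes M$ satisfying $\Delta(m_{(-1)})\otimes\mu^{-1}(m_0)=\alpha^{-1}(m_{(-1)})\otimes(m_{0(-1)}\otimes m_{00})$, $\rho(\mu(m))=\alpha(m_{(-1)})\otimes\mu(m_0)$, $\epsilon(m_{(-1)})m_0=\mu^{-1}(m)$, and $\rho(h\cdot m)=(h_{11}\alpha^{-1}(m_{(-1)}))S(h_2)\otimes\alpha(h_{12})\cdot m_0$. Morphisms are $H$-linear, $H$-colinear maps commuting with the structure automorphisms. Tensor products carry $h\cdot(m\otimes n)=h_1\cdot m\otimes h_2\cdot n$ and $\rho(m\otimes n)=m_{(-1)}n_{(-1)}\otimes(m_0\otimes n_0)$. The braiding is $C_{M,N}(m\otimes n)=m_{(-1)}\cdot\nu^{-1}(n)\otimes\mu(m_0)$ for $(M,\mu),(N,\nu)$. A monoidal Hom-algebra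 in ${}^{H}_{H}\mathcal{HYD}$ is an object $(A,\beta)$ that is a monoidal Hom-algebra whose multiplication and unit are morphisms: $h\cdot(ab)=(h_1\cdot a)(h_2\cdot b)$, $h\cdot1_A=\epsilon(h)1_A$, $\rho(ab)=a_{(-1)}b_{(-1)}\otimes a_0b_0$, $\rho(1_A)=1_H\otimes1_A$. The braiding $C$ is symmetric on $A$ if $a_{(-1)}\cdot\beta^{-1}(b)\otimes\beta(a_0)=\beta(b_0)\otimes S^{-1}(b_{(-1)})\cdot\beta^{-1}(a)$ for all $a,b\in A$. A braided Hom-Lie algebra (monoidal Hom-Lie algebra in ${}^{H}_{H}\mathcal{HYD}$) is a triple $(L,[\,,],\beta)$ where $(L,\beta)$ is an object of ${}^{H}_{H}\mathcal{HYD}$ ($\beta$ its structure automorphism) and $[\,,]:L\otimes L\to L$ is a morphism in ${}^{H}_{H}\mathcal{HYD}$ satisfying: (i) $[l,l']=-[l_{(-1)}\cdot\beta^{-1}(l'),\beta(l_0)]$; (ii) $\{l\otimes l'\otimes l''\}+\{(C\otimes1)(1\otimes C)(l\otimes l'\otimes l'')\}+\{(1\otimes C)(C\otimes1)(l\otimes l'\otimes l'')\}=0$, for all $l,l',l''\in L$, where $\{l\otimes l'\otimes l''\}=[\beta(l),[l',l'']]$, $C$ is the braiding of $L$, and $C\otimes 1$, $1\otimes C$ are taken as linear maps on the vector space $L\otimes L\otimes L$. *)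

(* Defs.v *)
From HB Require Import structures.
From mathcomp Require Import all_boot all_algebra.
From mathcomp Require Import boolp.

Set Implicit Arguments.
Unset Strict Implicit.
Unset Printing Implicit Defensive.

Import GRing.Theory.
Local Open Scope ring_scope.
Local Open Scope quotient_scope.


(** * Tensor product of two vector spaces

    [tensor U V] is the set of formal sums of pairs [(u, v)], modulo the least
    additive congruence that makes [(u, v)] bilinear. *)

Section Tensor.
Variables (k : fieldType) (U V : lmodType k).

Inductive tensor_rel : seq (U * V) -> seq (U * V) -> Prop :=
| TRefl s : tensor_rel s s
| TSym s t : tensor_rel s t -> tensor_rel t s
| TTrans s t r : tensor_rel s t -> tensor_rel t r -> tensor_rel s r
| TCat s s' t t' :
    tensor_rel s s' -> tensor_rel t t' -> tensor_rel (s ++ t) (s' ++ t')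
| TComm s t : tensor_rel (s ++ t) (t ++ s)
| TAddl u u' v : tensor_rel [:: (u + u', v)] [:: (u, v); (u', v)]
| TAddr u v v' : tensor_rel [:: (u, v + v')] [:: (u, v); (u, v')]
| TScale a u v : tensor_rel [:: (a *: u, v)] [:: (u, a *: v)]
| TZero v : tensor_rel [:: (0, v)] [::].

Definition tensor_relb : rel (seq (U * V)) := fun s t => `[< tensor_rel s t >].

Lemma tensor_relb_refl : reflexive tensor_relb.
Proof. by move=> s; apply/asboolP; apply: TRefl. Qed.

Lemma tensor_relb_sym : symmetric tensor_relb.
Proof. by move=> s t; apply/asboolP/asboolP; apply: TSym. Qed.

Lemma tensor_relb_trans : transitive tensor_relb.
Proof.
by move=> t s r /asboolP st /asboolP tr; apply/asboolP; apply: TTrans st tr.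
Qed.

Canonical tensor_equiv :=
  EquivRel tensor_relb tensor_relb_refl tensor_relb_sym tensor_relb_trans.

Definition tensor : Type := {eq_quot tensor_relb}.

HB.instance Definition _ := Choice.on tensor.
HB.instance Definition _ := EqQuotient.on tensor.

Lemma tensor_eqP s t : \pi_tensor s = \pi_tensor t <-> tensor_rel s t.
Proof. by split=> [/eqmodP/asboolP | st]; last apply/eqmodP/asboolP. Qed.

Lemma tensor_repr s : tensor_rel (repr (\pi_tensor s)) s.
Proof. by apply/tensor_eqP; rewrite reprK. Qed.

Definition tensor_zero : tensor := \pi_tensor [::].
Definition tensor_add (x y : tensor) : tensor := \pi_tensor (repr x ++ repr y).
Definition scale_seq (a : k) (s : seq (U * V)) := [seq (a *: p.1, p.2) | p <- s].
Definition tensor_scale (a : k) (x : tensor) : tensor :=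
  \pi_tensor (scale_seq a (repr x)).
Definition tensor_opp : tensor -> tensor := tensor_scale (-1).

Lemma pi_add s t : tensor_add (\pi_tensor s) (\pi t) = \pi_tensor (s ++ t).
Proof. by apply/tensor_eqP; apply: TCat; apply: tensor_repr. Qed.

Lemma scale_seq_rel a s t :
  tensor_rel s t -> tensor_rel (scale_seq a s) (scale_seq a t).
Proof.
elim=> {s t}.
- by move=> s; apply: TRefl.
- by move=> s t _; apply: TSym.
- by move=> s t r _ st _; apply: TTrans.
- by move=> s s' t t' _ ss' _ tt'; rewrite /scale_seq !map_cat; apply: TCat.
- by move=> s t; rewrite /scale_seq !map_cat; apply: TComm.
- by move=> u u' v; rewrite /= scalerDr; apply: TAddl.
- by move=> u v v'; apply: TAddr.
- move=> b u v; rewrite /= scalerA mulrC -scalerA; exact: TScale.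
- by move=> v; rewrite /= scaler0; apply: TZero.
Qed.

Lemma pi_scale a s : tensor_scale a (\pi_tensor s) = \pi_tensor (scale_seq a s).
Proof. by apply/tensor_eqP/scale_seq_rel/tensor_repr. Qed.

Lemma tensor_addA : associative tensor_add.
Proof.
move=> x y z; elim/quotW: x => s; elim/quotW: y => t; elim/quotW: z => r.
by rewrite (pi_add t r) (pi_add s) (pi_add s t) (pi_add _ r) catA.
Qed.

Lemma tensor_addC : commutative tensor_add.
Proof.
move=> x y; elim/quotW: x => s; elim/quotW: y => t; rewrite !pi_add.
by apply/tensor_eqP; apply: TComm.
Qed.

Lemma tensor_add0 : left_id tensor_zero tensor_add.
Proof. by move=> x; elim/quotW: x => s; rewrite pi_add. Qed.

Lemma tensor_scaleDl x :
  {morph tensor_scale^~ x : a b / a + b >-> tensor_add a b}.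
Proof.
elim/quotW: x => s a b; rewrite !(pi_scale _ s) pi_add; apply/tensor_eqP.
elim: s => [|[u v] s IHs] /=; first exact: TRefl.
rewrite -cat1s -[X in tensor_rel _ X]/([:: (a *: u, v)] ++ _).
apply: (TTrans (t := [:: (a *: u, v); (b *: u, v)] ++
                     (scale_seq a s ++ scale_seq b s))).
  by apply: TCat => //; rewrite scalerDl; apply: TAddl.
rewrite -[X in tensor_rel X _]/([:: (a *: u, v)] ++ _); apply: TCat.
  exact: TRefl.
rewrite -[X in tensor_rel _ (_ ++ X)]/([:: (b *: u, v)] ++ _).
rewrite -[X in tensor_rel X _]/([:: (b *: u, v)] ++ (_ ++ _)) !catA.
by apply: TCat; [apply: TComm | apply: TRefl].
Qed.

Lemma tensor_scale0 x : tensor_scale 0 x = tensor_zero.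
Proof.
elim/quotW: x => s; rewrite pi_scale; apply/tensor_eqP.
elim: s => [|[u v] s IHs] /=; first exact: TRefl.
rewrite -[X in tensor_rel _ X]/([::] ++ [::]) -cat1s.
by apply: TCat => //; rewrite scale0r; apply: TZero.
Qed.

Lemma tensor_scale1 : left_id 1 tensor_scale.
Proof.
move=> x; elim/quotW: x => s; rewrite pi_scale; congr (\pi_tensor _).
by rewrite -[RHS]map_id; apply: eq_map => -[u v]; rewrite /= scale1r.
Qed.

Lemma tensor_addN : left_inverse tensor_zero tensor_opp tensor_add.
Proof.
move=> x; rewrite -[X in tensor_add _ X]tensor_scale1 -tensor_scaleDl addNr.
exact: tensor_scale0.
Qed.

HB.instance Definition _ := GRing.isZmodule.Build tensor
  tensor_addA tensor_addC tensor_add0 tensor_addN.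

Lemma tensor_scaleA a b x :
  tensor_scale a (tensor_scale b x) = tensor_scale (a * b) x.
Proof.
elim/quotW: x => s; rewrite (pi_scale b s) !pi_scale; congr (\pi_tensor _).
by rewrite /scale_seq -map_comp; apply: eq_map => -[u v]; rewrite /= scalerA.
Qed.

Lemma tensor_scaleDr : right_distributive tensor_scale +%R.
Proof.
move=> a x y; elim/quotW: x => s; elim/quotW: y => t.
rewrite -![_ + _]/(tensor_add _ _) (pi_add s t) (pi_scale _ s) (pi_scale _ t).
by rewrite pi_scale pi_add /scale_seq map_cat.
Qed.

HB.instance Definition _ := GRing.Zmodule_isLmodule.Build k tensor
  tensor_scaleA tensor_scale1 tensor_scaleDr tensor_scaleDl.

Definition tens (u : U) (v : V) : tensor := \pi_tensor [:: (u, v)].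

Lemma tens_bilinear : bilinear_for *:%R *:%R tens.
Proof.
have scl a u v : a *: tens u v = tens (a *: u) v by rewrite [LHS]pi_scale.
split=> [v a u u' | u a v v'] /=.
  rewrite scl -[RHS]/(tensor_add _ _) pi_add.
  by apply/tensor_eqP; apply: TAddl.
rewrite scl -[RHS]/(tensor_add _ _) pi_add; apply/tensor_eqP.
apply: (TTrans (TAddr _ _ _)).
rewrite -[X in tensor_rel X _]/([:: _] ++ [:: _]).
rewrite -[X in tensor_rel _ X]/([:: _] ++ [:: _]).
apply: TCat; last exact: TRefl.
by apply: TSym; apply: TScale.
Qed.

HB.instance Definition _ :=
  bilinear_isBilinear.Build k U V tensor *:%R *:%R tens tens_bilinear.

Lemma tensE (x : tensor) : x = \sum_(p <- repr x) tens p.1 p.2.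
Proof.
rewrite -[LHS]reprK; elim: (repr x) => [|[u v] s IHs]; first by rewrite big_nil.
by rewrite big_cons -IHs -[RHS]/(tensor_add _ _) pi_add.
Qed.

End Tensor.

Notation "u ⊗ v" := (tens u v) (at level 45, left associativity) : ring_scope.

(** [tlift f] is the map out of [tensor U V] induced by [f].  It is
    representative-independent, hence linear, as soon as [f] is bilinear
    ([tlift_tens], [tlift_linear]); it is only ever used for such [f]. *)
Definition tlift (k : fieldType) (U V W : lmodType k) (f : U -> V -> W)
    (x : tensor U V) : W :=
  \sum_(p <- repr x) f p.1 p.2.

Notation "\swd_ ( u ⊗ v <- x ) E" := (tlift (fun u v => E) x)
  (at level 50, u name, v name, x at level 44, E at level 50,
   format "\swd_ ( u  ⊗  v  <-  x )  E") : ring_scope.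

Section Lift.
Variables (k : fieldType) (U V W : lmodType k).

Lemma tlift_pi (f : U -> V -> W) s : bilinear_for *:%R *:%R f ->
  tlift f (\pi_(tensor U V) s) = \sum_(p <- s) f p.1 p.2.
Proof.
move=> [fl fr]; rewrite /tlift.
have f0 v : f 0 v = 0.
  by have := fl v (-1) 0 0; rewrite /= scaler0 addr0 scaleN1r addNr.
have fDl u u' v : f (u + u') v = f u v + f u' v.
  by have := fl v 1 u u'; rewrite /= !scale1r.
have fDr u v v' : f u (v + v') = f u v + f u v'.
  by have := fr u 1 v v'; rewrite /= !scale1r.
have fZl a u v : f (a *: u) v = a *: f u v.
  by have := fl v a u 0; rewrite /= !addr0 f0 addr0.
have fr0 u : f u 0 = 0.
  by have := fr u (-1) 0 0; rewrite /= scaler0 addr0 scaleN1r addNr.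
have fZr a u v : f u (a *: v) = a *: f u v.
  by have := fr u a v 0; rewrite /= !addr0 fr0 addr0.
suff sumE s1 s2 : tensor_rel s1 s2 ->
    \sum_(p <- s1) f p.1 p.2 = \sum_(p <- s2) f p.1 p.2.
  exact/sumE/tensor_repr.
elim=> {s s1 s2} //.
- by move=> s t r _ -> _ ->.
- by move=> s s' t t' _ ss' _ tt'; rewrite !big_cat /= ss' tt'.
- by move=> s t; rewrite !big_cat /= addrC.
- by move=> u u' v; rewrite !big_cons !big_nil /= !addr0 fDl.
- by move=> u v v'; rewrite !big_cons !big_nil /= !addr0 fDr.
- by move=> a u v; rewrite !big_cons !big_nil /= fZl fZr.
- by move=> v; rewrite !big_cons !big_nil /= f0 addr0.
Qed.

Lemma tlift_tens (f : U -> V -> W) u v : bilinear_for *:%R *:%R f ->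
  tlift f (u ⊗ v) = f u v.
Proof. by move=> fP; rewrite /tens tlift_pi // big_seq1. Qed.

Lemma tlift_linear (f : U -> V -> W) : bilinear_for *:%R *:%R f ->
  linear (tlift f).
Proof.
move=> fP a x y; elim/quotW: x => s; elim/quotW: y => t.
rewrite -[_ + _]/(tensor_add (tensor_scale _ _) _) pi_scale pi_add.
rewrite !tlift_pi // big_cat /= /scale_seq big_map scaler_sumr; congr (_ + _).
case: fP => fl _; apply: eq_bigr => p _ /=.
have f0 v : f 0 v = 0.
  by have := fl v (-1) 0 0; rewrite /= scaler0 addr0 scaleN1r addNr.
by have := fl p.2 a p.1 0; rewrite /= !addr0 f0 addr0.
Qed.

Lemma tliftP (f g : U -> V -> W) a x :
  tlift (fun u v => a *: f u v + g u v) x = a *: tlift f x + tlift g x.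
Proof. by rewrite /tlift big_split /= scaler_sumr. Qed.

Lemma eq_tlift (f g : U -> V -> W) x : f =2 g -> tlift f x = tlift g x.
Proof. by move=> fg; apply: eq_bigr => p _; apply: fg. Qed.

Lemma bilinearP (f : {bilinear U -> V -> W}) : bilinear_for *:%R *:%R f.
Proof. by split=> [v|u] a x y; [rewrite linearPl | rewrite linearPr]. Qed.

Definition tlin (f : {bilinear U -> V -> W}) : tensor U V -> W := tlift f.

Lemma tlin_linear f : linear (tlin f).
Proof. exact/tlift_linear/bilinearP. Qed.

HB.instance Definition _ f :=
  GRing.isLinear.Build k (tensor U V) W *:%R (tlin f) (tlin_linear f).

End Lift.

Lemma tensor_ind (k : fieldType) (U V : lmodType k) (P : tensor U V -> Prop) :
  P 0 -> (forall x y, P x -> P y -> P (x + y)) -> (forall u v, P (u ⊗ v)) ->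
  forall x, P x.
Proof. by move=> P0 PD Pt x; rewrite [x]tensE; apply: big_ind. Qed.

Section TensorMap.
Variables (k : fieldType) (U V U' V' : lmodType k).
Variables (f : {linear U -> U'}) (g : {linear V -> V'}).

Definition tmap (x : tensor U V) : tensor U' V' := \swd_(u ⊗ v <- x) (f u ⊗ g v).

Lemma tmap_bilinear : bilinear_for *:%R *:%R (fun u v => f u ⊗ g v).
Proof. by split=> [v|u] a x y /=; rewrite linearP ?linearPl ?linearPr. Qed.

Lemma tmap_linear : linear tmap.
Proof. exact/tlift_linear/tmap_bilinear. Qed.

HB.instance Definition _ := GRing.isLinear.Build k _ _ *:%R tmap tmap_linear.

Lemma tmapE u v : tmap (u ⊗ v) = f u ⊗ g v.
Proof. exact/tlift_tens/tmap_bilinear. Qed.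

End TensorMap.

Section Associator.
Variables (k : fieldType) (U V W : lmodType k).

Definition tassoc (x : tensor (tensor U V) W) : tensor U (tensor V W) :=
  \swd_(y ⊗ w <- x) \swd_(u ⊗ v <- y) (u ⊗ (v ⊗ w)).

Definition tassocV (x : tensor U (tensor V W)) : tensor (tensor U V) W :=
  \swd_(u ⊗ y <- x) \swd_(v ⊗ w <- y) ((u ⊗ v) ⊗ w).

Lemma tassocE u v w : tassoc ((u ⊗ v) ⊗ w) = u ⊗ (v ⊗ w).
Proof.
have bil w' : bilinear_for *:%R *:%R (fun (u : U) (v : V) => u ⊗ (v ⊗ w')).
  by split=> [y|y] a x z /=; rewrite ?linearPl ?linearPr.
rewrite /tassoc tlift_tens ?tlift_tens //; split=> [w'|y] a x z.
  exact: tlift_linear.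
by rewrite -tliftP; apply: eq_tlift => u' v'; rewrite !linearPr.
Qed.

Lemma tassocVE u v w : tassocV (u ⊗ (v ⊗ w)) = (u ⊗ v) ⊗ w.
Proof.
have bil u' : bilinear_for *:%R *:%R (fun (v : V) (w : W) => (u' ⊗ v) ⊗ w).
  by split=> [y|y] a x z /=; rewrite ?linearPr ?linearPl.
rewrite /tassocV tlift_tens ?tlift_tens //; split=> [y|u'] a x z.
  by rewrite -tliftP; apply: eq_tlift => v' w'; rewrite !linearPl.
exact: tlift_linear.
Qed.

End Associator.

(** * Objects: a vector space with a linear automorphism *)

Record homObj (k : fieldType) := HomObj {
  hsort :> lmodType k;
  haut : {linear hsort -> hsort};
  hautV : {linear hsort -> hsort};
  hautK : cancel haut hautV;
  hautVK : cancel hautV haut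
}.

Section TensorObj.
Variables (k : fieldType) (X Y : homObj k).

Lemma tensor_hautK :
  cancel (tmap (haut X) (haut Y)) (tmap (hautV X) (hautV Y)).
Proof.
move=> z; elim/tensor_ind: z => [|x y IHx IHy|u v]; first by rewrite !linear0.
  by rewrite !linearD /= IHx IHy.
by rewrite !tmapE !hautK.
Qed.

Lemma tensor_hautVK :
  cancel (tmap (hautV X) (hautV Y)) (tmap (haut X) (haut Y)).
Proof.
move=> z; elim/tensor_ind: z => [|x y IHx IHy|u v]; first by rewrite !linear0.
  by rewrite !linearD /= IHx IHy.
by rewrite !tmapE !hautVK.
Qed.

Definition tensorObj : homObj k :=
  HomObj (hsort := tensor X Y) tensor_hautK tensor_hautVK.

End TensorObj.

Definition unitObj (k : fieldType) : homObj k :=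
  HomObj (hsort := k^o) (haut := idfun) (hautV := idfun)
    (fun=> erefl) (fun=> erefl).

(** * Monoidal Hom-algebras, Hom-coalgebras, Hom-Hopf algebras *)

Record is_hom_algebra (k : fieldType) (A : homObj k)
    (m : {bilinear A -> A -> A}) (e : A) : Prop := {
  ha_assoc : forall a b c, m (haut A a) (m b c) = m (m a b) (haut A c);
  ha_autM : forall a b, haut A (m a b) = m (haut A a) (haut A b);
  ha_mulr1 : forall a, m a e = haut A a;
  ha_mul1r : forall a, m e a = haut A a;
  ha_aut1 : haut A e = e
}.

Record is_hom_coalgebra (k : fieldType) (C : homObj k)
    (D : {linear C -> tensor C C}) (eps : {scalar C}) : Prop := {
  hc_coassoc : forall c,
    \swd_(c1 ⊗ c2 <- D c) \swd_(c21 ⊗ c22 <- D c2)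
      (hautV C c1 ⊗ (c21 ⊗ c22))
    = \swd_(c1 ⊗ c2 <- D c) \swd_(c11 ⊗ c12 <- D c1)
      (c11 ⊗ (c12 ⊗ hautV C c2));
  hc_autD : forall c, D (haut C c) = \swd_(c1 ⊗ c2 <- D c) (haut C c1 ⊗ haut C c2);
  hc_counitr : forall c, \swd_(c1 ⊗ c2 <- D c) (eps c2 *: c1) = hautV C c;
  hc_counitl : forall c, \swd_(c1 ⊗ c2 <- D c) (eps c1 *: c2) = hautV C c;
  hc_aut_eps : forall c, eps (haut C c) = eps c
}.

Record homHopf (k : fieldType) := HomHopf {
  hobj :> homObj k;
  hmul : {bilinear hobj -> hobj -> hobj};
  hone : hobj;
  hcomul : {linear hobj -> tensor hobj hobj};
  hcounit : {scalar hobj};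
  hanti : {linear hobj -> hobj};
  hopf_alg : is_hom_algebra hmul hone;
  hopf_coalg : is_hom_coalgebra hcomul hcounit;
  hcomulM : forall g h, hcomul (hmul g h)
    = \swd_(g1 ⊗ g2 <- hcomul g) \swd_(h1 ⊗ h2 <- hcomul h)
        (hmul g1 h1 ⊗ hmul g2 h2);
  hcomul1 : hcomul hone = hone ⊗ hone;
  hcounitM : forall g h, hcounit (hmul g h) = hcounit g * hcounit h;
  hcounit1 : hcounit hone = 1;
  hanti_aut : forall h, hanti (haut hobj h) = haut hobj (hanti h);
  hantil : forall h,
    \swd_(h1 ⊗ h2 <- hcomul h) hmul (hanti h1) h2 = hcounit h *: hone;
  hantir : forall h,
    \swd_(h1 ⊗ h2 <- hcomul h) hmul h1 (hanti h2) = hcounit h *: hone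
}.

(** * Left-left Hom-Yetter-Drinfeld modules *)

(** An object with a linear action and a linear coaction of [H], no axiom
    imposed (see [is_yd]): enough to say what it means for a map out of
    [M ⊗ N], or out of the unit object, to be a morphism. *)
Record ydData (k : fieldType) (H : homHopf k) := YDData {
  yobj :> homObj k;
  yact : {bilinear H -> yobj -> yobj};
  ycoact : {linear yobj -> tensor H yobj}
}.

Notation "h ▷ m" := (yact _ h m) (at level 38, right associativity) : ring_scope.

Record is_yd (k : fieldType) (H : homHopf k) (M : ydData H) : Prop := {
  yd_actA : forall g h (m : M),
    haut H h ▷ (g ▷ m) = hmul H h g ▷ haut M m;
  yd_act1 : forall m : M, hone H ▷ m = haut M m;
  yd_act_aut : forall h (m : M), haut M (h ▷ m) = haut H h ▷ haut M m;
  yd_coassoc : forall m : M,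
    \swd_(m1 ⊗ m0 <- ycoact M m) \swd_(m11 ⊗ m12 <- hcomul H m1)
      (m11 ⊗ (m12 ⊗ hautV M m0))
    = \swd_(m1 ⊗ m0 <- ycoact M m) \swd_(m01 ⊗ m00 <- ycoact M m0)
      (hautV H m1 ⊗ (m01 ⊗ m00));
  yd_coact_aut : forall m : M, ycoact M (haut M m)
    = \swd_(m1 ⊗ m0 <- ycoact M m) (haut H m1 ⊗ haut M m0);
  yd_counit : forall m : M,
    \swd_(m1 ⊗ m0 <- ycoact M m) (hcounit H m1 *: m0) = hautV M m;
  yd_compat : forall h (m : M), ycoact M (h ▷ m)
    = \swd_(h1 ⊗ h2 <- hcomul H h) \swd_(h11 ⊗ h12 <- hcomul H h1)
      \swd_(m1 ⊗ m0 <- ycoact M m)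
        (hmul H (hmul H h11 (hautV H m1)) (hanti H h2)
           ⊗ (haut H h12 ▷ m0))
}.

Record ydModule (k : fieldType) (H : homHopf k) := YDModule {
  ydata :> ydData H;
  ydataP : is_yd ydata
}.

Record is_yd_morphism (k : fieldType) (H : homHopf k) (M N : ydData H)
    (f : {linear M -> N}) : Prop := {
  ydm_aut : forall m, f (haut M m) = haut N (f m);
  ydm_act : forall h m, f (h ▷ m) = h ▷ f m;
  ydm_coact : forall m,
    ycoact N (f m) = \swd_(m1 ⊗ m0 <- ycoact M m) (m1 ⊗ f m0)
}.

Section YDTensor.
Variables (k : fieldType) (H : homHopf k) (M N : ydData H).

Definition tensor_act (h : H) (x : tensorObj M N) : tensorObj M N :=
  \swd_(h1 ⊗ h2 <- hcomul H h) \swd_(m ⊗ n <- x) ((h1 ▷ m) ⊗ (h2 ▷ n)).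

Definition tensor_coact (x : tensorObj M N) : tensor H (tensorObj M N) :=
  \swd_(m ⊗ n <- x)
    \swd_(m1 ⊗ m0 <- ycoact M m) \swd_(n1 ⊗ n0 <- ycoact N n)
      (hmul H m1 n1 ⊗ (m0 ⊗ n0)).

Lemma tensor_act_bilinear : bilinear_for *:%R *:%R tensor_act.
Proof.
have bil h1 h2 : bilinear_for *:%R *:%R
    (fun (m : M) (n : N) => (h1 ▷ m) ⊗ (h2 ▷ n)).
  by split=> [n|m] a x y /=; rewrite linearPr ?linearPl ?linearPr.
split=> [x|h] a.
  move=> g h; rewrite /tensor_act linearP tlift_linear //.
  split=> [h2|h1] b y z /=; rewrite -tliftP; apply: eq_tlift => m n.
    by rewrite !linearPl.
  by rewrite linearPl linearPr.
move=> x y; rewrite /tensor_act -tliftP; apply: eq_tlift => h1 h2.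
exact: tlift_linear.
Qed.

HB.instance Definition _ := bilinear_isBilinear.Build k _ _ _ *:%R *:%R
  tensor_act tensor_act_bilinear.

Lemma tensor_coact_linear : linear tensor_coact.
Proof.
have bil (m1 : H) (m0 : M) : bilinear_for *:%R *:%R
    (fun (n1 : H) (n0 : N) => hmul H m1 n1 ⊗ (m0 ⊗ n0)).
  split=> [n0|n1] a x y /=; first by rewrite linearPr linearPl.
  by rewrite !linearPr.
apply: tlift_linear; split=> [n|m] a x y /=.
  rewrite linearP tlift_linear //.
  split=> [m0|m1] b z t /=; rewrite -tliftP; apply: eq_tlift => n1 n0.
    by rewrite !linearPl.
  by rewrite linearPl linearPr.
rewrite linearP -tliftP; apply: eq_tlift => m1 m0; exact: tlift_linear.
Qed.

HB.instance Definition _ :=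
  GRing.isLinear.Build k _ _ *:%R tensor_coact tensor_coact_linear.

Definition ydTensor : ydData H :=
  YDData (yobj := tensorObj M N) tensor_act tensor_coact.

Definition braid (x : tensor M N) : tensor N M :=
  \swd_(m ⊗ n <- x)
    \swd_(m1 ⊗ m0 <- ycoact M m) ((m1 ▷ hautV N n) ⊗ haut M m0).

Lemma braid_linear : linear braid.
Proof.
apply: tlift_linear; split=> [n|m] a x y /=.
  rewrite linearP tlift_linear //.
  split=> [m0|m1] b z t /=; first by rewrite !linearPl.
  by rewrite linearP linearPr.
rewrite linearP -tliftP; apply: eq_tlift => m1 m0.
by rewrite linearPr linearPl.
Qed.

HB.instance Definition _ := GRing.isLinear.Build k _ _ *:%R braid braid_linear.

End YDTensor.

Section YDUnit.
Variables (k : fieldType) (H : homHopf k).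

Definition unit_act (h : H) (x : k^o) : k^o := hcounit H h *: x.

Lemma unit_act_bilinear : bilinear_for *:%R *:%R unit_act.
Proof.
split=> [x|h] a y z; rewrite /unit_act /=.
  by rewrite linearP scalerDl scalerA.
by rewrite scalerDr !scalerA mulrC.
Qed.

HB.instance Definition _ := bilinear_isBilinear.Build k _ _ _ *:%R *:%R
  unit_act unit_act_bilinear.

Definition unit_coact (x : k^o) : tensor H k^o := hone H ⊗ x.

Lemma unit_coact_linear : linear unit_coact.
Proof. by move=> a x y; rewrite /unit_coact linearPr. Qed.

HB.instance Definition _ :=
  GRing.isLinear.Build k _ _ *:%R unit_coact unit_coact_linear.

Definition ydUnit : ydData H :=
  YDData (yobj := unitObj k) unit_act unit_coact.

End YDUnit.

Section LineMap.
Variables (k : fieldType) (V : lmodType k) (v : V).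

Definition line_map (c : k^o) : V := c *: v.

Lemma line_map_linear : linear line_map.
Proof. by move=> a x y; rewrite /line_map scalerDl scalerA. Qed.

HB.instance Definition _ :=
  GRing.isLinear.Build k _ _ *:%R line_map line_map_linear.

End LineMap.

(** * Monoidal Hom-algebras in the Hom-Yetter-Drinfeld category *)

Record ydAlgebra (k : fieldType) (H : homHopf k) := YDAlgebra {
  ya_mod :> ydModule H;
  ya_mul : {bilinear ya_mod -> ya_mod -> ya_mod};
  ya_one : ya_mod;
  ya_alg : is_hom_algebra ya_mul ya_one;
  ya_mulP : is_yd_morphism (M := ydTensor ya_mod ya_mod) (N := ya_mod)
              (tlin ya_mul);
  ya_oneP : is_yd_morphism (M := ydUnit H) (N := ya_mod) (line_map ya_one)
}.

(** [SV] stands for the inverse of the antipode. *)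
Definition braiding_symmetric_on (k : fieldType) (H : homHopf k)
    (SV : H -> H) (A : ydModule H) : Prop :=
  forall a b : A,
    \swd_(a1 ⊗ a0 <- ycoact A a) ((a1 ▷ hautV A b) ⊗ haut A a0)
    = \swd_(b1 ⊗ b0 <- ycoact A b) (haut A b0 ⊗ (SV b1 ▷ hautV A a)).

(** * Braided Hom-Lie algebras *)

Section BraidedHomLie.
Variables (k : fieldType) (H : homHopf k) (L : ydModule H).

Definition braidl : tensor (tensor L L) L -> tensor (tensor L L) L :=
  tmap (@braid k H L L) idfun.

Definition braidr (x : tensor (tensor L L) L) : tensor (tensor L L) L :=
  tassocV (tmap idfun (@braid k H L L) (tassoc x)).

Variable br : {bilinear L -> L -> L}.

Definition curly (x : tensor (tensor L L) L) : L :=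
  \swd_(y ⊗ l'' <- x) \swd_(l ⊗ l' <- y) br (haut L l) (br l' l'').

Record is_braided_hom_lie : Prop := {
  bhl_morph : is_yd_morphism (M := ydTensor L L) (N := L) (tlin br);
  bhl_skew : forall l l', br l l'
    = - \swd_(l1 ⊗ l0 <- ycoact L l) br (l1 ▷ hautV L l') (haut L l0);
  bhl_jacobi : forall l l' l'',
    curly ((l ⊗ l') ⊗ l'')
    + curly (braidl (braidr ((l ⊗ l') ⊗ l'')))
    + curly (braidr (braidl ((l ⊗ l') ⊗ l''))) = 0
}.

End BraidedHomLie.

Section Bracket.
Variables (k : fieldType) (H : homHopf k) (A : ydAlgebra H).

Definition yd_bracket (a b : A) : A :=
  ya_mul A a b
  - \swd_(a1 ⊗ a0 <- ycoact A a) ya_mul A (a1 ▷ hautV A b) (haut A a0).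

Lemma yd_bracket_bilinear : bilinear_for *:%R *:%R yd_bracket.
Proof.
split=> [b|a] c x y; rewrite /yd_bracket /=.
  rewrite linearPl linearP tlift_linear; last first.
    split=> [m0|m1] d z t /=; first by rewrite !linearPl.
    by rewrite linearP linearPr.
  by rewrite scalerBr opprD addrACA.
rewrite linearPr linearP.
rewrite (eq_tlift _ (g := fun a1 a0 =>
  c *: ya_mul A (a1 ▷ hautV A x) (haut A a0)
  + ya_mul A (a1 ▷ hautV A y) (haut A a0))); last first.
  by move=> a1 a0; rewrite linearPr linearPl.
by rewrite tliftP scalerBr opprD addrACA.
Qed.

HB.instance Definition _ := bilinear_isBilinear.Build k _ _ _ *:%R *:%R
  yd_bracket yd_bracket_bilinear.

End Bracket.

(* Main.v *)
Require Import Defs.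
From HB Require Import structures.
From mathcomp Require Import all_boot all_algebra.

(** Replacing the product [m] of an object with automorphism [β] by [β^-1 m],
    the action by [β^-1] of it, and comultiplications and coactions by their
    images under the automorphisms turns every Hom-structure into an ordinary
    Hopf algebra, Yetter-Drinfeld module or algebra, on which the braiding [C]
    takes its classical form without changing as a map. There [C] is a
    morphism, satisfies the Yang-Baxter equation, and has [C o (1 ⊗ m) =
    (m ⊗ 1) o C2 C1] with [C1 = C ⊗ 1], [C2 = 1 ⊗ C]. As the antipode is
    antimultiplicative, the symmetry hypothesis says [C o C = 1], so [C1] and
    [C2] generate an action of the symmetric group on three letters. Since
    [[,] = m o (1 - C)], skew symmetry is [(1 - C)(1 + C) = 0]; the iterated
    bracket is [m3 (1 - C2 C1)(1 - C2)] up to [β], where [m3] is the triple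
    product, and summing over the cyclic group generated by [C2 C1] kills
    it. *)

Set Implicit Arguments.
Unset Strict Implicit.
Unset Printing Implicit Defensive.

Import GRing.Theory.
Local Open Scope ring_scope.

Notation bilin f := (bilinear_for *:%R *:%R f).

(** * Multilinear maps and Sweedler sums *)

Section Multilinear.
Variable k : fieldType.
Implicit Types U V W X Y : lmodType k.

Lemma lin_id U : linear (fun x : U => x).
Proof. by []. Qed.

Lemma lin_app U V W (L : V -> W) (f : U -> V) :
  linear L -> linear f -> linear (fun x => L (f x)).
Proof. by move=> lL lf a x y; rewrite lf lL. Qed.

Lemma lin_appl U V V' W (B : V -> V' -> W) (f : U -> V) c :
  bilin B -> linear f -> linear (fun x => B (f x) c).
Proof. by move=> [lB _] lf a x y; rewrite lf (lB c). Qed.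

Lemma lin_appr U V V' W (B : V -> V' -> W) (f : U -> V') c :
  bilin B -> linear f -> linear (fun x => B c (f x)).
Proof. by move=> [_ lB] lf a x y; rewrite lf (lB c). Qed.

Lemma lin_bilr V V' W (B : {bilinear V -> V' -> W}) c : linear (B c).
Proof. by move=> a x y; rewrite linearPr. Qed.

Lemma lin_scalel U V W (e : {scalar V}) (f : U -> V) (w : W) :
  linear f -> linear (fun x => e (f x) *: w).
Proof. by move=> lf a x y; rewrite lf linearP scalerDl scalerA. Qed.

Lemma lin_scaler U V (c : k) (f : U -> V) :
  linear f -> linear (fun x => c *: f x).
Proof.
by move=> lf a x y; rewrite lf scalerDr !scalerA mulrC.
Qed.

Lemma lin_add U V (f g : U -> V) :
  linear f -> linear g -> linear (fun x => f x + g x).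
Proof. by move=> lf lg a x y; rewrite lf lg scalerDr addrACA. Qed.

Lemma lin_opp U V (f : U -> V) : linear f -> linear (fun x => - f x).
Proof. by move=> lf a x y; rewrite lf scalerN opprD. Qed.

(** As [c] is fixed, all the sums run over one and the same representative, and linearity in the
    parameter passes term by term. *)
Lemma lin_tlift U V W X (F : X -> U -> V -> W) (c : tensor U V) :
  (forall u v, linear (fun x => F x u v)) -> linear (fun x => tlift (F x) c).
Proof.
by move=> lF a x y; rewrite -tliftP; apply: eq_tlift => u v; rewrite lF.
Qed.

Lemma lin_tlift_arg U V W X (F : U -> V -> W) (f : X -> tensor U V) :
  bilin F -> linear f -> linear (fun x => tlift F (f x)).
Proof. by move=> bF; apply: lin_app; apply: tlift_linear. Qed.

Lemma linear_tlift U V W X (L : W -> X) (F : U -> V -> W) (x : tensor U V) :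
  linear L -> L (tlift F x) = tlift (fun u v => L (F u v)) x.
Proof.
move=> lL.
have L0 : L 0 = 0 by have := lL (-1) 0 0; rewrite scaler0 addr0 scaleN1r addNr.
have LD u v : L (u + v) = L u + L v by have := lL 1 u v; rewrite !scale1r.
exact: (big_morph L LD L0).
Qed.

Lemma exchange_tlift U V U' V' W (F : U -> V -> U' -> V' -> W)
    (x : tensor U V) (y : tensor U' V') :
  \swd_(u ⊗ v <- x) \swd_(u' ⊗ v' <- y) F u v u' v'
  = \swd_(u' ⊗ v' <- y) \swd_(u ⊗ v <- x) F u v u' v'.
Proof. exact: exchange_big. Qed.

Lemma tlift_tlift U V U' V' W (G : U' -> V' -> W)
    (F : U -> V -> tensor U' V') (x : tensor U V) : bilin G ->
  tlift G (\swd_(u ⊗ v <- x) F u v) = \swd_(u ⊗ v <- x) tlift G (F u v).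
Proof. by move=> bG; apply: linear_tlift; apply: tlift_linear. Qed.

Lemma tensor_tlift U V (x : tensor U V) : \swd_(u ⊗ v <- x) (u ⊗ v) = x.
Proof. by rewrite [RHS]tensE. Qed.

Definition trilin U V W X (f : U -> V -> W -> X) : Prop :=
  [/\ forall v w, linear (fun u => f u v w),
      forall u w, linear (fun v => f u v w) &
      forall u v, linear (fun w => f u v w)].

End Multilinear.

(** Since [tlift] sums over a chosen representative, rules such as [tlift_tens] carry bilinearity
    side conditions. They are proved by recursion on the syntax of the summand. *)
Ltac lin :=
  cbv beta; intros;
  lazymatch goal with
  | |- bilinear_for _ _ _ =>
      first [exact: bilinearP | (split => ?; lin)]
  | |- trilin _ => split; lin
  | |- GRing.linear_for _ (fun x => x) => exact: lin_id
  | |- GRing.linear_for _ (fun x => tlift _ _) =>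
      first [(apply: lin_tlift; lin) | (apply: lin_tlift_arg; lin)]
  | |- GRing.linear_for _ (fun x => _ + _) => apply: lin_add; lin
  | |- GRing.linear_for _ (fun x => - _) => apply: lin_opp; lin
  | |- GRing.linear_for _ (fun x => _ *: _) =>
      first [(apply: lin_scaler; lin) | (apply: lin_scalel; lin)]
  | |- _ => first [ exact: linearP | exact: lin_bilr | assumption
           | (apply: lin_appl; [exact: bilinearP | lin])
           | (apply: lin_appr; [exact: bilinearP | lin])
           | (apply: lin_app; [first [exact: linearP | assumption] | lin]) ]
  end.

Section Trilinear.
Variables (k : fieldType) (U V W X : lmodType k).

(** The coassociativity axioms are equations between triple tensors. Applying [tlift3 f] to both
    sides turns them into rules for an arbitrary trilinear expression in the three Sweedler
    components. *)
Definition tlift3 (f : U -> V -> W -> X) (x : tensor U (tensor V W)) : X :=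
  \swd_(u ⊗ y <- x) tlift (f u) y.

Lemma tlift3_linear (f : U -> V -> W -> X) : trilin f -> linear (tlift3 f).
Proof.
move=> [f1 f2 f3]; apply: tlift_linear; split=> [y|u].
  by apply: lin_tlift => v w.
by apply: tlift_linear; split=> ?.
Qed.

Lemma tlift3_tens (f : U -> V -> W -> X) u v w : trilin f ->
  tlift3 f (u ⊗ (v ⊗ w)) = f u v w.
Proof.
move=> [f1 f2 f3]; rewrite /tlift3 tlift_tens ?tlift_tens //; split=> [y|u'] //.
  by apply: lin_tlift => v' w'.
by apply: tlift_linear; split=> ?.
Qed.

Lemma tlift3_swd (f : U -> V -> W -> X) (Y Z Y' Z' : lmodType k)
    (x : tensor Y Z) (y : Y -> Z -> tensor Y' Z')
    (p : Y -> Z -> Y' -> Z' -> U) (q : Y -> Z -> Y' -> Z' -> V)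
    (r : Y -> Z -> Y' -> Z' -> W) : trilin f ->
  tlift3 f (\swd_(a ⊗ b <- x) \swd_(c ⊗ d <- y a b)
              (p a b c d ⊗ (q a b c d ⊗ r a b c d)))
  = \swd_(a ⊗ b <- x) \swd_(c ⊗ d <- y a b)
      f (p a b c d) (q a b c d) (r a b c d).
Proof.
move=> tf; rewrite (linear_tlift _ _ (tlift3_linear tf)).
apply: eq_tlift => a b; rewrite (linear_tlift _ _ (tlift3_linear tf)).
by apply: eq_tlift => c d; rewrite tlift3_tens.
Qed.

End Trilinear.

(** * Classical Hopf algebras and Yetter-Drinfeld modules *)

(** A predicate on separate maps rather than a bundled structure, so that the untwisted operations
    can be placed on the vector space that already carries the Hom-structure. *)
Record is_hopf (k : fieldType) (H : lmodType k) (mul : {bilinear H -> H -> H})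
    (one : H) (D : {linear H -> tensor H H}) (eps : {scalar H})
    (S : {linear H -> H}) : Prop := {
  hopf_mulA : forall a b c, mul a (mul b c) = mul (mul a b) c;
  hopf_mulr1 : forall a, mul a one = a;
  hopf_mul1r : forall a, mul one a = a;
  hopf_coassoc : forall h,
    \swd_(h1 ⊗ h2 <- D h) \swd_(h21 ⊗ h22 <- D h2) (h1 ⊗ (h21 ⊗ h22))
    = \swd_(h1 ⊗ h2 <- D h) \swd_(h11 ⊗ h12 <- D h1) (h11 ⊗ (h12 ⊗ h2));
  hopf_counitr : forall h, \swd_(h1 ⊗ h2 <- D h) (eps h2 *: h1) = h;
  hopf_counitl : forall h, \swd_(h1 ⊗ h2 <- D h) (eps h1 *: h2) = h;
  hopf_comulM : forall g h, D (mul g h)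
    = \swd_(g1 ⊗ g2 <- D g) \swd_(h1 ⊗ h2 <- D h) (mul g1 h1 ⊗ mul g2 h2);
  hopf_comul1 : D one = one ⊗ one;
  hopf_counitM : forall g h, eps (mul g h) = eps g * eps h;
  hopf_counit1 : eps one = 1;
  hopf_antil : forall h, \swd_(h1 ⊗ h2 <- D h) mul (S h1) h2 = eps h *: one;
  hopf_antir : forall h, \swd_(h1 ⊗ h2 <- D h) mul h1 (S h2) = eps h *: one
}.

Section Hopf.
Variables (k : fieldType) (H : lmodType k) (mul : {bilinear H -> H -> H}).
Variables (one : H) (D : {linear H -> tensor H H}) (eps : {scalar H}).
Variables (S : {linear H -> H}) (hH : is_hopf mul one D eps S).
Variable W : lmodType k.

Lemma coassoc (f : H -> H -> H -> W) h : trilin f ->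
  \swd_(h1 ⊗ h2 <- D h) \swd_(h21 ⊗ h22 <- D h2) f h1 h21 h22
  = \swd_(h1 ⊗ h2 <- D h) \swd_(h11 ⊗ h12 <- D h1) f h11 h12 h2.
Proof.
by move=> tf; rewrite -!tlift3_swd // (hopf_coassoc hH).
Qed.

Lemma counitr (f : H -> W) h : linear f ->
  \swd_(h1 ⊗ h2 <- D h) (eps h2 *: f h1) = f h.
Proof.
move=> lf; rewrite -[in RHS](hopf_counitr hH h) (linear_tlift _ _ lf).
by apply: eq_tlift => h1 h2; rewrite (scalable_linear lf).
Qed.

Lemma counitl (f : H -> W) h : linear f ->
  \swd_(h1 ⊗ h2 <- D h) (eps h1 *: f h2) = f h.
Proof.
move=> lf; rewrite -[in RHS](hopf_counitl hH h) (linear_tlift _ _ lf).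
by apply: eq_tlift => h1 h2; rewrite (scalable_linear lf).
Qed.

End Hopf.

(** * Antimultiplicativity of the antipode, and its inverse *)

Section Antipode.
Variables (k : fieldType) (H : lmodType k) (mul : {bilinear H -> H -> H}).
Variables (one : H) (D : {linear H -> tensor H H}) (eps : {scalar H}).
Variables (S : {linear H -> H}) (hH : is_hopf mul one D eps S).

Lemma antip_one : S one = one.
Proof.
have := hopf_antil hH one; rewrite (hopf_comul1 hH) tlift_tens; last by lin.
by rewrite (hopf_mulr1 hH) (hopf_counit1 hH) scale1r.
Qed.

(** In the convolution algebra of maps [H ⊗ H -> H], this makes [S(h) S(g)] a right inverse of the
    multiplication. The inner sum over [h] collapses first and leaves the antipode axiom for [g]. *)
Lemma antip_mul_convr g h :
  \swd_(g1 ⊗ g2 <- D g) \swd_(h1 ⊗ h2 <- D h)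
    mul (mul g1 h1) (mul (S h2) (S g2)) = eps g *: (eps h *: one).
Proof.
transitivity (\swd_(g1 ⊗ g2 <- D g)
    mul g1 (mul (\swd_(h1 ⊗ h2 <- D h) mul h1 (S h2)) (S g2))).
  apply: eq_tlift => g1 g2.
  rewrite (linear_tlift (L := fun x => mul g1 (mul x (S g2)))); last by lin.
  by apply: eq_tlift => h1 h2; rewrite -!(hopf_mulA hH).
rewrite (hopf_antir hH) scalerA mulrC -scalerA -(hopf_antir hH g).
rewrite (linear_tlift (L := GRing.scale (eps h))); last by lin.
by apply: eq_tlift => g1 g2; rewrite linearZl_LR (hopf_mul1r hH) linearZr_LR.
Qed.

(** As the comultiplication is multiplicative, this is the left antipode axiom at the product [gh]:
    [S(gh)] is a left convolution inverse of the multiplication. *)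
Lemma antip_mul_convl g h :
  \swd_(g1 ⊗ g2 <- D g) \swd_(h1 ⊗ h2 <- D h)
    mul (S (mul g1 h1)) (mul g2 h2) = eps g *: (eps h *: one).
Proof.
rewrite scalerA -(hopf_counitM hH) -(hopf_antil hH) (hopf_comulM hH).
rewrite tlift_tlift; last by lin.
apply: eq_tlift => g1 g2; rewrite tlift_tlift; last by lin.
by apply: eq_tlift => h1 h2; rewrite tlift_tens //; lin.
Qed.

(* Both sides are convolution inverses of the multiplication [H ⊗ H -> H]: the
   triple convolution [S(gh) * gh * S(h)S(g)] is evaluated in two ways. *)
Lemma antip_mul g h : S (mul g h) = mul (S h) (S g).
Proof.
transitivity (\swd_(g1 ⊗ g2 <- D g) \swd_(g21 ⊗ g22 <- D g2)
  \swd_(h1 ⊗ h2 <- D h) \swd_(h21 ⊗ h22 <- D h2)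
  mul (S (mul g1 h1)) (mul (mul g21 h21) (mul (S h22) (S g22)))).
  rewrite -[LHS](counitr hH (f := fun x => S (mul x h))); last by lin.
  apply: eq_tlift => g1 g2; rewrite exchange_tlift /=.
  rewrite -[S _](counitr hH (f := fun x => S (mul g1 x))); last by lin.
  rewrite (linear_tlift (L := GRing.scale (eps g2))); last by lin.
  apply: eq_tlift => h1 h2.
  rewrite -[in LHS](hopf_mulr1 hH (S _)) -!linearZr_LR -antip_mul_convr.
  rewrite (linear_tlift (L := mul _)); last by lin.
  apply: eq_tlift => g21 g22.
  by rewrite (linear_tlift (L := mul _)); last by lin.
rewrite (coassoc hH); last by lin.
symmetry; rewrite -[LHS](counitl hH (f := fun x => mul (S h) (S x)));
  last by lin.
apply: eq_tlift => g1 g2.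
under [RHS]eq_tlift => g11 g12 do [rewrite (coassoc hH); last by lin].
rewrite exchange_tlift /=.
rewrite -[mul _ _](counitl hH (f := fun x => mul (S x) (S g2))); last by lin.
rewrite (linear_tlift (L := GRing.scale (eps g1))); last by lin.
apply: eq_tlift => h1 h2.
rewrite -[in LHS](hopf_mul1r hH (mul _ _)) -!linearZl_LR -antip_mul_convl.
rewrite (linear_tlift (L := fun x => mul x _)); last by lin.
apply: eq_tlift => g11 g12.
rewrite (linear_tlift (L := fun x => mul x _)); last by lin.
by apply: eq_tlift => h11 h12; rewrite !(hopf_mulA hH).
Qed.

Variables (SV : H -> H) (SK : cancel S SV) (SVK : cancel SV S).

Lemma antipV_linear : linear SV.
Proof. exact: (can2_linear SK SVK). Qed.

(** The injective map [S] reverses products, so it carries [h2 SV(h1)] to [h1 S(h2)], where the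
    right antipode axiom applies. *)
Lemma antipVr h :
  \swd_(h1 ⊗ h2 <- D h) mul h2 (SV h1) = eps h *: one.
Proof.
have lV := antipV_linear.
apply: (can_inj SK); rewrite linearZ /= antip_one -(hopf_antir hH).
rewrite (linear_tlift (L := S)); last by lin.
by apply: eq_tlift => h1 h2; rewrite antip_mul SVK.
Qed.

Lemma antipl_lin (W : lmodType k) (f : H -> W) h : linear f ->
  \swd_(h1 ⊗ h2 <- D h) f (mul (S h1) h2) = eps h *: f one.
Proof.
move=> lf; rewrite -(scalable_linear lf) -(hopf_antil hH) linear_tlift //.
Qed.

Lemma antipVr_lin (W : lmodType k) (f : H -> W) h : linear f ->
  \swd_(h1 ⊗ h2 <- D h) f (mul h2 (SV h1)) = eps h *: f one.
Proof.
move=> lf; rewrite -(scalable_linear lf) -antipVr linear_tlift //.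
Qed.

End Antipode.

(** * Classical Yetter-Drinfeld modules and their braiding *)

Record is_classical_yd (k : fieldType) (H : lmodType k)
    (mul : {bilinear H -> H -> H}) (one : H) (D : {linear H -> tensor H H})
    (eps : {scalar H})
    (S : {linear H -> H}) (M : lmodType k) (act : {bilinear H -> M -> M})
    (co : {linear M -> tensor H M}) : Prop := {
  cyd_actA : forall g h m, act g (act h m) = act (mul g h) m;
  cyd_act1 : forall m, act one m = m;
  cyd_coassoc : forall m,
    \swd_(m1 ⊗ m0 <- co m) \swd_(m01 ⊗ m00 <- co m0) (m1 ⊗ (m01 ⊗ m00))
    = \swd_(m1 ⊗ m0 <- co m) \swd_(m11 ⊗ m12 <- D m1) (m11 ⊗ (m12 ⊗ m0));
  cyd_counit : forall m, \swd_(m1 ⊗ m0 <- co m) (eps m1 *: m0) = m;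
  cyd_compat : forall h m, co (act h m)
    = \swd_(h1 ⊗ h2 <- D h) \swd_(h11 ⊗ h12 <- D h1) \swd_(m1 ⊗ m0 <- co m)
        (mul (mul h11 m1) (S h2) ⊗ act h12 m0)
}.

Section YD.
Variables (k : fieldType) (H : lmodType k) (mul : {bilinear H -> H -> H}).
Variables (one : H) (D : {linear H -> tensor H H}) (eps : {scalar H}).
Variables (S : {linear H -> H}) (hH : is_hopf mul one D eps S).
Variables (M : lmodType k) (actM : {bilinear H -> M -> M}).
Variables (coM : {linear M -> tensor H M}).
Variable (hM : is_classical_yd mul one D eps S actM coM).

Lemma ycoassoc (W : lmodType k) (f : H -> H -> M -> W) m : trilin f ->
  \swd_(m1 ⊗ m0 <- coM m) \swd_(m01 ⊗ m00 <- coM m0) f m1 m01 m00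
  = \swd_(m1 ⊗ m0 <- coM m) \swd_(m11 ⊗ m12 <- D m1) f m11 m12 m0.
Proof. by move=> tf; rewrite -!tlift3_swd // (cyd_coassoc hM). Qed.

Lemma ycounit (W : lmodType k) (f : M -> W) m : linear f ->
  \swd_(m1 ⊗ m0 <- coM m) (eps m1 *: f m0) = f m.
Proof.
move=> lf; rewrite -[in RHS](cyd_counit hM m) (linear_tlift _ _ lf).
by apply: eq_tlift => h1 h2; rewrite (scalable_linear lf).
Qed.

Variables (N : lmodType k) (actN : {bilinear H -> N -> N}).
Variables (coN : {linear N -> tensor H N}).
Variable (hN : is_classical_yd mul one D eps S actN coN).

Definition cbraid (m : M) (n : N) : tensor N M :=
  \swd_(m1 ⊗ m0 <- coM m) (actN m1 n ⊗ m0).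

Lemma cbraid_bilin : bilin cbraid.
Proof. by rewrite /cbraid; lin. Qed.

HB.instance Definition _ :=
  bilinear_isBilinear.Build k M N (tensor N M) *:%R *:%R cbraid cbraid_bilin.

(** This is [H]-linearity of the braiding. The coaction of [h1 · m] ends in a factor [S(h12)], which
    meets [h2] acting on [n] and cancels by the antipode axiom. *)
Lemma cbraid_act h m n :
  \swd_(h1 ⊗ h2 <- D h) cbraid (actM h1 m) (actN h2 n)
  = \swd_(h1 ⊗ h2 <- D h) \swd_(m1 ⊗ m0 <- coM m)
      (actN h1 (actN m1 n) ⊗ actM h2 m0).
Proof.
rewrite /cbraid.
under [LHS]eq_tlift => h1 h2.
  rewrite (cyd_compat hM) tlift_tlift; last by lin.
  under eq_tlift => h11 h12.
    rewrite tlift_tlift; last by lin.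
    under eq_tlift => h111 h112.
      rewrite tlift_tlift; last by lin.
      under eq_tlift => m1 m0 do [rewrite tlift_tens; last by lin].
      over.
    over.
  over.
(* Regrouping makes the argument of [S] and the element acting on [n] the two legs of one
   comultiplication. *)
rewrite -(coassoc hH (f := fun p q r => \swd_(h1 ⊗ h2 <- D p)
  \swd_(m1 ⊗ m0 <- coM m)
    (actN (mul (mul h1 m1) (S q)) (actN r n) ⊗ actM h2 m0))); last by lin.
(* A counit is inserted on the right so that both sides become sums over the same [p ⊗ q]; the
   antipode axiom will produce [eps q] on the left. *)
rewrite -[RHS](counitr hH (f := fun p => \swd_(h1 ⊗ h2 <- D p)
  \swd_(m1 ⊗ m0 <- coM m) (actN h1 (actN m1 n) ⊗ actM h2 m0))); last by lin.
apply: eq_tlift => p q.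
transitivity (\swd_(q1 ⊗ q2 <- D q) \swd_(h1 ⊗ h2 <- D p)
  \swd_(m1 ⊗ m0 <- coM m)
    (actN (mul (mul h1 m1) (mul (S q1) q2)) n ⊗ actM h2 m0)).
  do 3 apply: eq_tlift => ? ?; by rewrite (cyd_actA hN) -!(hopf_mulA hH).
rewrite (antipl_lin hH (f := fun x => \swd_(h1 ⊗ h2 <- D p)
  \swd_(m1 ⊗ m0 <- coM m) (actN (mul (mul h1 m1) x) n ⊗ actM h2 m0)));
  last by lin.
by congr (_ *: _); do 2 apply: eq_tlift => ? ?;
  rewrite (hopf_mulr1 hH) (cyd_actA hN).
Qed.

(** This is [H]-colinearity of the braiding, again through cancellation of the [S] that the
    compatibility condition introduces. *)
Lemma cbraid_coact m n :
  \swd_(y ⊗ x <- cbraid m n) \swd_(y1 ⊗ y0 <- coN y) \swd_(x1 ⊗ x0 <- coM x)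
     (mul y1 x1 ⊗ (y0 ⊗ x0))
  = \swd_(m1 ⊗ m0 <- coM m) \swd_(n1 ⊗ n0 <- coN n)
     (mul m1 n1 ⊗ cbraid m0 n0).
Proof.
transitivity (\swd_(m1 ⊗ m0 <- coM m) \swd_(m01 ⊗ m00 <- coM m0)
  \swd_(p ⊗ q <- D m1) \swd_(p1 ⊗ p2 <- D p) \swd_(n1 ⊗ n0 <- coN n)
    (mul (mul (mul p1 n1) (S q)) m01 ⊗ (actN p2 n0 ⊗ m00))).
  rewrite /cbraid tlift_tlift; last by lin.
  apply: eq_tlift => m1 m0; rewrite tlift_tens; last by lin.
  rewrite exchange_tlift; apply: eq_tlift => m01 m00.
  rewrite (cyd_compat hN) tlift_tlift; last by lin.
  apply: eq_tlift => p q; rewrite tlift_tlift; last by lin.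
  apply: eq_tlift => p1 p2; rewrite tlift_tlift; last by lin.
  by apply: eq_tlift => n1 n0; rewrite tlift_tens //; lin.
(* The factor [m01] becomes the second leg of the comultiplication of [m1], so that it can cancel
   against [S q]. *)
rewrite (ycoassoc (f := fun x y z => \swd_(p ⊗ q <- D x)
  \swd_(p1 ⊗ p2 <- D p) \swd_(n1 ⊗ n0 <- coN n)
    (mul (mul (mul p1 n1) (S q)) y ⊗ (actN p2 n0 ⊗ z)))); last by lin.
transitivity (\swd_(m1 ⊗ m0 <- coM m) \swd_(p ⊗ q <- D m1)
  \swd_(n1 ⊗ n0 <- coN n) (mul p n1 ⊗ (actN q n0 ⊗ m0))).
  apply: eq_tlift => m1 m0.
  rewrite -(coassoc hH (f := fun p q r => \swd_(p1 ⊗ p2 <- D p)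
    \swd_(n1 ⊗ n0 <- coN n)
      (mul (mul (mul p1 n1) (S q)) r ⊗ (actN p2 n0 ⊗ m0)))); last by lin.
  rewrite -[RHS](counitr hH (f := fun x => \swd_(p ⊗ q <- D x)
    \swd_(n1 ⊗ n0 <- coN n) (mul p n1 ⊗ (actN q n0 ⊗ m0)))); last by lin.
  apply: eq_tlift => p q.
  transitivity (\swd_(q1 ⊗ q2 <- D q) \swd_(p1 ⊗ p2 <- D p)
    \swd_(n1 ⊗ n0 <- coN n)
      (mul (mul p1 n1) (mul (S q1) q2) ⊗ (actN p2 n0 ⊗ m0))).
    by do 3 apply: eq_tlift => ? ?; rewrite !(hopf_mulA hH).
  rewrite (antipl_lin hH (f := fun x => \swd_(p1 ⊗ p2 <- D p)
    \swd_(n1 ⊗ n0 <- coN n)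
      (mul (mul p1 n1) x ⊗ (actN p2 n0 ⊗ m0)))); last by lin.
  by congr (_ *: _); do 2 apply: eq_tlift => ? ?; rewrite (hopf_mulr1 hH).
(* Coassociativity is now used backwards: the leg acting on [n0] is again part of the coaction of
   [m0], which rebuilds the braiding of [m0] and [n0]. *)
rewrite -(ycoassoc (f := fun x y z =>
  \swd_(n1 ⊗ n0 <- coN n) (mul x n1 ⊗ (actN y n0 ⊗ z)))); last by lin.
apply: eq_tlift => m1 m0; rewrite exchange_tlift; apply: eq_tlift => n1 n0.
by rewrite (linear_tlift (L := tens _)); last by lin.
Qed.

(** Naturality of the braiding in its second argument with respect to [m]. Passing [a] over [b] and
    then over [c] applies the coaction twice; by coassociativity this is one coaction followed by
    the comultiplication, hence the action on [m b c]. *)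
Lemma cbraid_natural_mul (m : {bilinear N -> N -> N}) a b c :
  (forall h, actN h (m b c)
     = \swd_(h1 ⊗ h2 <- D h) m (actN h1 b) (actN h2 c)) ->
  \swd_(y ⊗ x <- cbraid a b) \swd_(z ⊗ w <- cbraid x c) (m y z ⊗ w)
  = cbraid a (m b c).
Proof.
move=> act_m; rewrite [in LHS]/cbraid tlift_tlift; last by rewrite /cbraid; lin.
transitivity (\swd_(a1 ⊗ a0 <- coM a) \swd_(a01 ⊗ a00 <- coM a0)
  (m (actN a1 b) (actN a01 c) ⊗ a00)).
  apply: eq_tlift => a1 a0; rewrite tlift_tens; last by rewrite /cbraid; lin.
  rewrite /cbraid tlift_tlift; last by lin.
  by apply: eq_tlift => a01 a00; rewrite tlift_tens //; lin.
rewrite (ycoassoc (f := fun x y z => m (actN x b) (actN y c) ⊗ z));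
  last by lin.
apply: eq_tlift => a1 a0.
by rewrite act_m [RHS](linear_tlift (L := fun x => tens x _)); last by lin.
Qed.

(** Exhibits a right inverse of the braiding. By coassociativity the two elements acting on [n]
    multiply to [h2 SV(h1)] for [h] the coaction component of [m], and this is a counit. *)
Lemma cbraid_cancel (SV : H -> H) (SK : cancel S SV) (SVK : cancel SV S) m n :
  \swd_(m1 ⊗ m0 <- coM m) cbraid m0 (actN (SV m1) n) = n ⊗ m.
Proof.
have lV := antipV_linear SK SVK.
rewrite /cbraid (ycoassoc (f := fun x y z => actN y (actN (SV x) n) ⊗ z));
  last by lin.
rewrite -[RHS](ycounit (f := tens n)); last by lin.
apply: eq_tlift => m1 m0.
rewrite -[in RHS](cyd_act1 hN n).
rewrite -(antipVr_lin hH SK SVK (f := fun x => actN x n ⊗ m0)); last by lin.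
by apply: eq_tlift => h1 h2; rewrite (cyd_actA hN).
Qed.

End YD.

(** * The Yang-Baxter equation for the classical braiding *)

Section YangBaxter.
Variables (k : fieldType) (H : lmodType k) (mul : {bilinear H -> H -> H}).
Variables (one : H) (D : {linear H -> tensor H H}) (eps : {scalar H}).
Variables (S : {linear H -> H}) (hH : is_hopf mul one D eps S).
Variables (M N P : lmodType k).
Variables (actM : {bilinear H -> M -> M}) (coM : {linear M -> tensor H M}).
Variables (actN : {bilinear H -> N -> N}) (coN : {linear N -> tensor H N}).
Variables (actP : {bilinear H -> P -> P}) (coP : {linear P -> tensor H P}).
Hypothesis hM : is_classical_yd mul one D eps S actM coM.
Hypothesis hN : is_classical_yd mul one D eps S actN coN.
Hypothesis hP : is_classical_yd mul one D eps S actP coP.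

(** By coassociativity of the coaction of [m], the right side is the braiding of [n] and [p] after
    the diagonal action of [m1], the left side the same action after the braiding. The two agree
    because the braiding is [H]-linear. *)
Lemma cbraid_yang_baxter m n p :
  \swd_(p1 ⊗ n1 <- cbraid coN actP n p) \swd_(p2 ⊗ m1 <- cbraid coM actP m p1)
    \swd_(n2 ⊗ m2 <- cbraid coM actN m1 n1) (p2 ⊗ n2 ⊗ m2)
  = \swd_(n1 ⊗ m1 <- cbraid coM actN m n) \swd_(p1 ⊗ m2 <- cbraid coM actP m1 p)
    \swd_(p2 ⊗ n2 <- cbraid coN actP n1 p1) (p2 ⊗ n2 ⊗ m2).
Proof.
transitivity (\swd_(n1 ⊗ n0 <- coN n) \swd_(m1 ⊗ m0 <- coM m)
  \swd_(m01 ⊗ m00 <- coM m0)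
    (actP m1 (actP n1 p) ⊗ actN m01 n0 ⊗ m00)).
  rewrite [cbraid coN _ _ _]/cbraid tlift_tlift; last by rewrite /cbraid; lin.
  apply: eq_tlift => n1 n0; rewrite tlift_tens; last by rewrite /cbraid; lin.
  rewrite [cbraid coM _ m _]/cbraid tlift_tlift; last by rewrite /cbraid; lin.
  apply: eq_tlift => m1 m0; rewrite tlift_tens; last by rewrite /cbraid; lin.
  rewrite /cbraid tlift_tlift; last by lin.
  by apply: eq_tlift => m01 m00; rewrite tlift_tens //; lin.
rewrite exchange_tlift; symmetry.
transitivity (\swd_(m1 ⊗ m0 <- coM m) \swd_(m01 ⊗ m00 <- coM m0)
  (cbraid coN actP (actN m1 n) (actP m01 p) ⊗ m00)).
  rewrite [cbraid coM actN m n]/cbraid tlift_tlift;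
    last by rewrite /cbraid; lin.
  apply: eq_tlift => m1 m0; rewrite tlift_tens; last by rewrite /cbraid; lin.
  rewrite [cbraid coM _ _ _]/cbraid tlift_tlift; last by rewrite /cbraid; lin.
  apply: eq_tlift => m01 m00; rewrite tlift_tens; last by rewrite /cbraid; lin.
  rewrite -(linear_tlift (L := fun x => x ⊗ m00)); last by lin.
  by rewrite tensor_tlift.
rewrite (ycoassoc hM (f := fun x y z =>
  cbraid coN actP (actN x n) (actP y p) ⊗ z)); last by lin.
under [RHS]eq_tlift => m1 m0 do rewrite exchange_tlift.
rewrite [RHS](ycoassoc hM (f := fun x y z => \swd_(n1 ⊗ n0 <- coN n)
  (actP x (actP n1 p) ⊗ actN y n0 ⊗ z))); last by lin.
apply: eq_tlift => m1 m0.
rewrite -(linear_tlift (L := fun x => x ⊗ m0)); last by lin.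
rewrite (cbraid_act hH hN hP).
rewrite (linear_tlift (L := fun x => x ⊗ m0)); last by lin.
apply: eq_tlift => h1 h2.
by rewrite (linear_tlift (L := fun x => x ⊗ m0)); last by lin.
Qed.

End YangBaxter.

Lemma tlift_tmap (k : fieldType) (U V U' V' W : lmodType k)
    (f : {linear U -> U'}) (g : {linear V -> V'}) (F : U' -> V' -> W)
    (x : tensor U V) : bilin F ->
  tlift F (tmap f g x) = \swd_(u ⊗ v <- x) F (f u) (g v).
Proof.
move=> bF; rewrite /tmap tlift_tlift //.
by apply: eq_tlift => u v; rewrite tlift_tens.
Qed.

(** * Untwisting Hom-structures *)

Section UntwistHopf.
Variables (k : fieldType) (H : homHopf k).
Let alg := hopf_alg H.
Let coalg := hopf_coalg H.

Definition umul (g h : H) : H := hautV H (hmul H g h).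

Lemma umul_bilin : bilin umul.
Proof. by rewrite /umul; lin. Qed.

HB.instance Definition _ :=
  bilinear_isBilinear.Build k H H H *:%R *:%R umul umul_bilin.

Definition uD (h : H) : tensor H H := tmap (haut H) (haut H) (hcomul H h).

Lemma uD_linear : linear uD.
Proof. by rewrite /uD; lin. Qed.

HB.instance Definition _ := GRing.isLinear.Build k H _ *:%R uD uD_linear.

Lemma uDV h : uD (hautV H h) = hcomul H h.
Proof. by rewrite /uD /tmap -(hc_autD coalg) hautVK. Qed.

Lemma hautV_mul (g h : H) :
  hautV H (hmul H g h) = hmul H (hautV H g) (hautV H h).
Proof.
by apply: (can_inj (@hautK _ H)); rewrite hautVK (ha_autM alg) !hautVK.
Qed.

Lemma tlift_uD (W : lmodType k) (F : H -> H -> W) h : bilin F ->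
  tlift F (uD h) = \swd_(h1 ⊗ h2 <- hcomul H h) F (haut H h1) (haut H h2).
Proof. exact: tlift_tmap. Qed.

Lemma uD_aut h : uD (haut H h) = tmap (haut H) (haut H) (uD h).
Proof. by rewrite {1}/uD (hc_autD coalg). Qed.

Lemma untwist_hopf : is_hopf umul (hone H) uD (hcounit H) (hanti H).
Proof.
split.
(* Two nested untwisted products contain two inverse automorphisms; applying [α] twice clears both
   and leaves Hom-associativity. *)
- move=> a b c; apply: (can_inj (@hautK _ H)); apply: (can_inj (@hautK _ H)).
  by rewrite /umul !(hautVK, ha_autM alg) (ha_assoc alg).
- by move=> a; rewrite /= /umul (ha_mulr1 alg) hautK.
- by move=> a; rewrite /= /umul (ha_mul1r alg) hautK.
- move=> h; rewrite !tlift_uD; try by lin.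
  transitivity (\swd_(h1 ⊗ h2 <- hcomul H h) \swd_(h21 ⊗ h22 <- hcomul H h2)
    (haut H h1 ⊗ (haut H (haut H h21) ⊗ haut H (haut H h22)))).
    apply: eq_tlift => h1 h2.
    by rewrite /= uD_aut tlift_tmap ?tlift_uD //; lin.
  transitivity (\swd_(h1 ⊗ h2 <- hcomul H h) \swd_(h11 ⊗ h12 <- hcomul H h1)
    (haut H (haut H h11) ⊗ (haut H (haut H h12) ⊗ haut H h2))); last first.
    apply: eq_tlift => h1 h2.
    by rewrite /= uD_aut tlift_tmap ?tlift_uD //; lin.
  (* Hom-coassociativity is taken to its image under [α^2] on all three factors. Its single [α^-1]
     on an outer factor then leaves exactly the one [α] present there. *)
  have tf : trilin (fun x y z : H =>
    haut H (haut H x) ⊗ (haut H (haut H y) ⊗ haut H (haut H z))) by lin.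
  have := congr1 (tlift3 (fun x y z : H =>
    haut H (haut H x) ⊗ (haut H (haut H y) ⊗ haut H (haut H z))))
    (hc_coassoc coalg h).
  rewrite !tlift3_swd //.
  under eq_tlift => h1 h2 do under eq_tlift => h21 h22 do rewrite hautVK.
  under [in RHS]eq_tlift => h1 h2 do
    under eq_tlift => h11 h12 do rewrite hautVK.
  by [].
- move=> h; rewrite tlift_uD; last by lin.
  rewrite -[RHS](@hautVK _ H h) -(hc_counitr coalg).
  rewrite (linear_tlift (L := haut H)); last by lin.
  by apply: eq_tlift => h1 h2; rewrite (hc_aut_eps coalg) linearZ.
- move=> h; rewrite tlift_uD; last by lin.
  rewrite -[RHS](@hautVK _ H h) -(hc_counitl coalg).
  rewrite (linear_tlift (L := haut H)); last by lin.
  by apply: eq_tlift => h1 h2; rewrite (hc_aut_eps coalg) linearZ.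
- move=> g h; rewrite /= uDV hcomulM tlift_uD; last by lin.
  apply: eq_tlift => g1 g2; rewrite tlift_uD; last by lin.
  by apply: eq_tlift => h1 h2; rewrite /= /umul !hautV_mul !hautK.
- by rewrite /= /uD hcomul1 tmapE (ha_aut1 alg).
- by move=> g h; rewrite -[LHS](hc_aut_eps coalg) hautVK hcounitM.
- exact: hcounit1.
- move=> h; rewrite tlift_uD; last by lin.
  rewrite -hantil; apply: eq_tlift => h1 h2.
  by rewrite /= /umul hanti_aut hautV_mul !hautK.
- move=> h; rewrite tlift_uD; last by lin.
  rewrite -hantir; apply: eq_tlift => h1 h2.
  by rewrite /= /umul hanti_aut hautV_mul !hautK.
Qed.

End UntwistHopf.

Lemma tensor_ext (k : fieldType) (U V W : lmodType k) (f g : tensor U V -> W) :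
  linear f -> linear g -> (forall u v, f (u ⊗ v) = g (u ⊗ v)) -> f =1 g.
Proof.
move=> lf lg fg x.
rewrite -(tensor_tlift x) (linear_tlift _ _ lf) (linear_tlift _ _ lg).
exact: eq_tlift.
Qed.

Lemma tmap_can (k : fieldType) (U V U' V' : lmodType k)
    (f : {linear U -> U'}) (f' : {linear U' -> U})
    (g : {linear V -> V'}) (g' : {linear V' -> V}) :
  cancel f f' -> cancel g g' -> cancel (tmap f g) (tmap f' g').
Proof.
move=> fK gK; apply: (@tensor_ext _ _ _ _ _ id) => [||u v]; [by lin | by lin |].
by rewrite !tmapE fK gK.
Qed.

(** * Untwisting Hom-Yetter-Drinfeld modules *)

Section UntwistYD.
Variables (k : fieldType) (H : homHopf k) (M : ydModule H).
Let coalg := hopf_coalg H.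
Let ydM := ydataP M.

Definition uact (h : H) (m : M) : M := hautV M (h ▷ m).

Lemma uact_bilin : bilin uact.
Proof. by rewrite /uact; lin. Qed.

HB.instance Definition _ :=
  bilinear_isBilinear.Build k H M M *:%R *:%R uact uact_bilin.

Definition uco (m : M) : tensor H M := tmap (haut H) (haut M) (ycoact M m).

Lemma uco_linear : linear uco.
Proof. by rewrite /uco; lin. Qed.

HB.instance Definition _ := GRing.isLinear.Build k M _ *:%R uco uco_linear.

Lemma uactE h m : h ▷ m = haut M (uact h m).
Proof. by rewrite /uact hautVK. Qed.

Lemma hautV_act h (m : M) : hautV M (h ▷ m) = hautV H h ▷ hautV M m.
Proof.
by apply: (can_inj (@hautK _ M)); rewrite hautVK (yd_act_aut ydM) !hautVK.
Qed.

Lemma haut_uact h (m : M) : haut M (uact h m) = uact (haut H h) (haut M m).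
Proof. by rewrite /uact -(yd_act_aut ydM) hautVK hautK. Qed.

Lemma tlift_uco (W : lmodType k) (F : H -> M -> W) m : bilin F ->
  tlift F (uco m) = \swd_(m1 ⊗ m0 <- ycoact M m) F (haut H m1) (haut M m0).
Proof. exact: tlift_tmap. Qed.

Lemma uco_aut m : uco (haut M m) = tmap (haut H) (haut M) (uco m).
Proof. by rewrite {1}/uco (yd_coact_aut ydM). Qed.

Lemma ucoV m : uco (hautV M m) = ycoact M m.
Proof. by rewrite /uco /tmap -(yd_coact_aut ydM) hautVK. Qed.

Lemma untwist_yd :
  is_classical_yd (@umul k H) (hone H) (@uD k H) (hcounit H) (hanti H) uact uco.
Proof.
split.
- move=> g h m; rewrite /= /uact /umul.
  apply: (can_inj (@hautK _ M)); apply: (can_inj (@hautK _ M)).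
  by rewrite !(hautVK, yd_act_aut ydM) (yd_actA ydM).
- by move=> m; rewrite /= /uact (yd_act1 ydM) hautK.
- move=> m; rewrite !tlift_uco; try by lin.
  transitivity (\swd_(m1 ⊗ m0 <- ycoact M m) \swd_(m01 ⊗ m00 <- ycoact M m0)
    (haut H m1 ⊗ (haut H (haut H m01) ⊗ haut M (haut M m00)))).
    apply: eq_tlift => m1 m0.
    by rewrite /= uco_aut tlift_tmap ?tlift_uco //; lin.
  transitivity (\swd_(m1 ⊗ m0 <- ycoact M m) \swd_(m11 ⊗ m12 <- hcomul H m1)
    (haut H (haut H m11) ⊗ (haut H (haut H m12) ⊗ haut M m0))); last first.
    apply: eq_tlift => m1 m0.
    by rewrite /= uD_aut tlift_tmap ?tlift_uD //; lin.
  have tf : trilin (fun (x y : H) (z : M) =>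
    haut H (haut H x) ⊗ (haut H (haut H y) ⊗ haut M (haut M z))) by lin.
  have := congr1 (tlift3 (fun (x y : H) (z : M) =>
    haut H (haut H x) ⊗ (haut H (haut H y) ⊗ haut M (haut M z))))
    (yd_coassoc ydM m).
  rewrite !tlift3_swd //.
  under eq_tlift => h1 h2 do under eq_tlift => h21 h22 do rewrite hautVK.
  under [in RHS]eq_tlift => h1 h2 do
    under eq_tlift => h11 h12 do rewrite hautVK.
  by [].
- move=> m; rewrite tlift_uco; last by lin.
  rewrite -[RHS](@hautVK _ M m) -(yd_counit ydM).
  rewrite (linear_tlift (L := haut M)); last by lin.
  by apply: eq_tlift => m1 m0; rewrite (hc_aut_eps coalg) linearZ.
(* The inverse automorphism in [uact] undoes the twist in [uco], so the Hom-compatibility condition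
   applies to the original coaction. *)
- move=> h m; rewrite [LHS]ucoV (yd_compat ydM) tlift_uD; last by lin.
  apply: eq_tlift => h1 h2; rewrite /= uD_aut tlift_tmap; last by lin.
  rewrite tlift_uD; last by lin.
  apply: eq_tlift => h11 h12; rewrite tlift_uco; last by lin.
  apply: eq_tlift => m1 m0.
  by rewrite /= /umul /uact hanti_aut !(hautV_mul, hautV_act, hautK).
Qed.

End UntwistYD.

(** * The braiding of Hom-Yetter-Drinfeld modules as a morphism *)

Section Braid.
Variables (k : fieldType) (H : homHopf k) (M N : ydModule H).

Let hH := untwist_hopf H.
Let hM := untwist_yd M.
Let hN := untwist_yd N.

(** The twists cancel: the [α] in [uco] and the inverse automorphism in [uact] combine to [m1]
    acting on the inverse image of [n], and the automorphism on [m0] is the one in the definition of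
    [C]. *)
Lemma braid_tens (m : M) (n : N) :
  braid (m ⊗ n) = cbraid (@uco k H M) (@uact k H N) m n.
Proof.
rewrite /braid tlift_tens; last by lin.
rewrite /cbraid tlift_uco; last by lin.
by apply: eq_tlift => m1 m0; rewrite /= /uact hautV_act hautK.
Qed.

Lemma cbraid_aut (m : M) (n : N) :
  cbraid (@uco k H M) (@uact k H N) (haut M m) (haut N n)
  = tmap (haut N) (haut M) (cbraid (@uco k H M) (@uact k H N) m n).
Proof.
rewrite /cbraid /= uco_aut tlift_tmap; last by lin.
rewrite (linear_tlift (L := tmap _ _)); last by lin.
by apply: eq_tlift => m1 m0; rewrite tmapE haut_uact.
Qed.

Lemma braid_morphism :
  is_yd_morphism (M := ydTensor M N) (N := ydTensor N M) (@braid k H M N).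
Proof.
split.
- apply: tensor_ext => [||m n]; [by lin | by lin |].
  by rewrite /= tmapE !braid_tens cbraid_aut.
- move=> h; apply: tensor_ext => [||m n]; [by lin | by lin |].
  rewrite /= /tensor_act braid_tens.
  (* The original comultiplication of [h] is the untwisted one at [α^-1(h)], and each original
     action is the untwisted one followed by the automorphism; this reduces the claim to
     [cbraid_act]. *)
  transitivity (tmap (haut N) (haut M) (\swd_(h1 ⊗ h2 <- uD (hautV H h))
    \swd_(m1 ⊗ m0 <- uco m) (uact h1 (uact m1 n) ⊗ uact h2 m0))).
    rewrite -(cbraid_act hH hM hN) /= uDV.
    rewrite !(linear_tlift (L := tmap _ _)); last by lin.
    rewrite (linear_tlift (L := @braid k H M N)); last by lin.
    apply: eq_tlift => h1 h2; rewrite tlift_tens; last by lin.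
    by rewrite braid_tens !uactE cbraid_aut.
  rewrite /= uDV (linear_tlift (L := tmap _ _)); last by lin.
  apply: eq_tlift => h1 h2; rewrite [in RHS]/cbraid tlift_tlift; last by lin.
  rewrite (linear_tlift (L := tmap _ _)); last by lin.
  apply: eq_tlift => m1 m0.
  by rewrite tmapE tlift_tens ?uactE //; lin.
- apply: tensor_ext => [||m n]; [by lin | by lin |].
  (* Under this injective map the coaction on a tensor product becomes the untwisted one: the [α^-1]
     in [umul] cancels the [α] of the two coactions, while the module factors receive their
     automorphisms. *)
  have inj : injective (tmap (@idfun H) (tmap (haut N) (haut M))).
    by apply: (can_inj (g := tmap (@idfun H) (tmap (hautV N) (hautV M))));
      apply: tmap_can => //; apply: tmap_can; apply: hautK.
  apply: inj.
  transitivity (\swd_(y ⊗ x <- cbraid (@uco k H M) (@uact k H N) m n)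
      \swd_(y1 ⊗ y0 <- uco y) \swd_(x1 ⊗ x0 <- uco x)
      (umul y1 x1 ⊗ (y0 ⊗ x0))).
    rewrite /= braid_tens (linear_tlift (L := tmap _ _)); last by lin.
    apply: eq_tlift => y x; rewrite (linear_tlift (L := tmap _ _)); last by lin.
    rewrite tlift_uco; last by lin.
    apply: eq_tlift => y1 y0.
    rewrite (linear_tlift (L := tmap _ _)); last by lin.
    rewrite tlift_uco; last by lin.
    by apply: eq_tlift => x1 x0; rewrite !tmapE /= tmapE /umul hautV_mul !hautK.
  apply: etrans (cbraid_coact hH hM hN m n) _; rewrite /= /tensor_coact.
  rewrite tlift_tens; last by lin.
  rewrite tlift_uco; last by rewrite /cbraid; lin.
  rewrite tlift_tlift; last by lin.
  rewrite (linear_tlift (L := tmap _ _)); last by lin.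
  apply: eq_tlift => m1 m0; rewrite tlift_uco; last by rewrite /cbraid; lin.
  rewrite tlift_tlift; last by lin.
  rewrite (linear_tlift (L := tmap _ _)); last by lin.
  apply: eq_tlift => n1 n0; rewrite tlift_tens; last by lin.
  by rewrite tmapE /= /umul hautV_mul !hautK braid_tens cbraid_aut.
Qed.
End Braid.

(** * The bracket *)

Section TripleTensor.
Variables (k : fieldType) (U V W : lmodType k).

Lemma tassoc_linear : linear (@tassoc k U V W).
Proof. by rewrite /tassoc; lin. Qed.

Lemma tassocV_linear : linear (@tassocV k U V W).
Proof. by rewrite /tassocV; lin. Qed.

HB.instance Definition _ :=
  GRing.isLinear.Build k _ _ *:%R (@tassoc k U V W) tassoc_linear.
HB.instance Definition _ :=
  GRing.isLinear.Build k _ _ *:%R (@tassocV k U V W) tassocV_linear.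

Lemma tensor3_ext (X : lmodType k) (f g : tensor (tensor U V) W -> X) :
  linear f -> linear g ->
  (forall u v w, f (u ⊗ v ⊗ w) = g (u ⊗ v ⊗ w)) -> f =1 g.
Proof.
move=> lf lg fg; apply: tensor_ext => // y w; move: y.
apply: (@tensor_ext _ _ _ _ (fun y => f (y ⊗ w)) (fun y => g (y ⊗ w))) => //.
  by apply: lin_app => //; lin.
by apply: lin_app => //; lin.
Qed.

Lemma tassocVK : cancel (@tassocV k U V W) (@tassoc k U V W).
Proof.
apply: (@tensor_ext _ _ _ _ _ id) => [||u y]; [by lin | by lin |].
move: y; apply: (@tensor_ext _ _ _ _ _ (tens u)) => [||v w];
  [by lin | by lin |].
by rewrite /= tassocVE tassocE.
Qed.

Lemma tassocK : cancel (@tassoc k U V W) (@tassocV k U V W).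
Proof.
apply: (@tensor3_ext _ _ id) => [||u v w]; [by lin | by lin |].
by rewrite /= tassocE tassocVE.
Qed.

End TripleTensor.

(** * The bracket as [m o (1 - C)], and why it is a morphism *)

Section Bracket.
Variables (k : fieldType) (H : homHopf k) (A : ydAlgebra H).
Let alg := ya_alg A.
Let mulP := ya_mulP A.
Let hH := untwist_hopf H.
Let hA := untwist_yd A.

Local Notation C := (@braid k H A A).
Local Notation c := (cbraid (@uco k H A) (@uact k H A)).
Local Notation C1 := (@braidl k H A).
Local Notation C2 := (@braidr k H A).
Local Notation m := (tlin (ya_mul A)).
Local Notation br := (tlin (yd_bracket (A := A))).

Lemma bracketE x : br x = m x - m (C x).
Proof.
move: x; apply: tensor_ext => [||a b]; [by lin | by lin |].
rewrite /tlin !tlift_tens; try by lin.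
rewrite /braid tlift_tens; last by lin.
rewrite tlift_tlift; last by lin.
rewrite /= /yd_bracket; congr (_ - _).
by apply: eq_tlift => a1 a0; rewrite tlift_tens //; lin.
Qed.

(** Both [m] and [m o C] are morphisms, hence so is their difference. *)
Lemma bracket_morphism : is_yd_morphism (M := ydTensor A A) (N := A) br.
Proof.
have CP := braid_morphism A A.
split.
- by move=> x; rewrite /= !bracketE (ydm_aut CP) !(ydm_aut mulP) linearB.
- by move=> h x; rewrite /= !bracketE (ydm_act CP) !(ydm_act mulP) linearBr.
- move=> x; rewrite /= bracketE linearB !(ydm_coact mulP) (ydm_coact CP) /=.
  rewrite [X in _ - X]tlift_tlift; last by lin.
  under [X in _ - X]eq_tlift => x1 x0 do [rewrite tlift_tens; last by lin].
  rewrite addrC -scaleN1r.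
  rewrite -tliftP; apply: eq_tlift => x1 x0.
  by rewrite bracketE linearBr scaleN1r addrC.
Qed.

(** * Involutivity and braid relation on triple tensors under the symmetry hypothesis *)

Section Symmetric.
Variables (SV : H -> H) (SK : cancel (hanti H) SV) (SVK : cancel SV (hanti H)).
Hypothesis symA : braiding_symmetric_on SV A.

(* The right-hand side of the symmetry hypothesis is the inverse of [C]. *)
Lemma braidK : involutive C.
Proof.
apply: (@tensor_ext _ _ _ _ _ id) => [||a b]; [by lin | by lin |].
rewrite -[RHS](cbraid_cancel hH hA hA SK SVK).
rewrite {2}/braid tlift_tens; last by lin.
rewrite symA (linear_tlift (L := C)); last by lin.
rewrite tlift_uco; last first.
  by have lV := antipV_linear SK SVK; rewrite /cbraid; lin.
apply: eq_tlift => b1 b0; rewrite braid_tens.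
rewrite /= /uact hautV_act.
suff -> : SV (haut H b1) = haut H (SV b1) by rewrite hautK.
by apply: (can_inj SK); rewrite SVK hanti_aut SVK.
Qed.

Lemma braidlK : involutive C1.
Proof. by apply: tmap_can => //; apply: braidK. Qed.

Lemma braidrK : involutive C2.
Proof.
move=> t; rewrite /braidr tassocVK (tmap_can (f' := idfun) (g' := C)) //.
  exact: tassocK.
exact: braidK.
Qed.

Lemma braidr_linear : linear C2.
Proof. by rewrite /braidr; lin. Qed.

HB.instance Definition _ := GRing.isLinear.Build k _ _ *:%R C2 braidr_linear.

Lemma braidl_linear : linear C1.
Proof. by rewrite /braidl; lin. Qed.

HB.instance Definition _ := GRing.isLinear.Build k _ _ *:%R C1 braidl_linear.

Lemma braidl_tens (a b d : A) :
  C1 (a ⊗ b ⊗ d) = \swd_(y ⊗ x <- c a b) (y ⊗ x ⊗ d).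
Proof.
rewrite /braidl tmapE /= braid_tens -{1}(tensor_tlift (c a b)).
by rewrite (linear_tlift (L := fun z => z ⊗ d)); last by lin.
Qed.

Lemma braidr_tens (a b d : A) :
  C2 (a ⊗ b ⊗ d) = \swd_(y ⊗ x <- c b d) (a ⊗ y ⊗ x).
Proof.
rewrite /braidr tassocE tmapE /= braid_tens -{1}(tensor_tlift (c b d)).
rewrite (linear_tlift (L := fun z => tassocV (a ⊗ z))); last by lin.
by apply: eq_tlift => y x; rewrite tassocVE.
Qed.

Lemma braid_yang_baxter t : C2 (C1 (C2 t)) = C1 (C2 (C1 t)).
Proof.
move: t; apply: tensor3_ext => [||a b d]; [by lin | by lin |].
rewrite braidr_tens braidl_tens.
transitivity (\swd_(y ⊗ x <- c b d) \swd_(z ⊗ w <- c a y)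
  \swd_(u ⊗ v <- c w x) (z ⊗ u ⊗ v)).
  rewrite (linear_tlift (L := fun z => C2 (C1 z))); last by lin.
  apply: eq_tlift => y x; rewrite braidl_tens.
  rewrite (linear_tlift (L := C2)); last by lin.
  by apply: eq_tlift => z w; rewrite braidr_tens.
rewrite (cbraid_yang_baxter hH hA hA hA).
rewrite (linear_tlift (L := fun z => C1 (C2 z))); last by lin.
apply: eq_tlift => y x; rewrite braidr_tens.
rewrite (linear_tlift (L := C1)); last by lin.
by apply: eq_tlift => z w; rewrite braidl_tens.
Qed.

(** * The untwisted product, triple products and the Jacobi identity *)

Definition yamul (a b : A) : A := hautV A (ya_mul A a b).

Lemma yamul_bilin : bilin yamul.
Proof. by rewrite /yamul; lin. Qed.

HB.instance Definition _ :=
  bilinear_isBilinear.Build k A A A *:%R *:%R yamul yamul_bilin.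

Lemma yamul_assoc a b d : yamul a (yamul b d) = yamul (yamul a b) d.
Proof.
apply: (can_inj (@hautK _ A)); apply: (can_inj (@hautK _ A)).
by rewrite /yamul !(hautVK, ha_autM alg) (ha_assoc alg).
Qed.

(** This is the hypothesis that [cbraid_natural_mul] requires of the untwisted product. After two
    applications of [β] it is [H]-linearity of the original product at [α(h)]. *)
Lemma uact_yamul h a b : uact h (yamul a b)
  = \swd_(h1 ⊗ h2 <- uD h) yamul (uact h1 a) (uact h2 b).
Proof.
apply: (can_inj (@hautK _ A)); apply: (can_inj (@hautK _ A)).
rewrite /= -uactE (yd_act_aut (ydataP A)) /yamul hautVK.
rewrite -[ya_mul A a b](tlift_tens (f := ya_mul A)); last by lin.
have /= <- := ydm_act mulP (haut H h) (a ⊗ b).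
rewrite /tensor_act -uDV hautK !(linear_tlift (L := m)); last by lin.
rewrite !(linear_tlift (L := haut A)); try by lin.
apply: eq_tlift => h1 h2; rewrite tlift_tens; last by lin.
by rewrite hautVK (ha_autM alg) -!uactE [LHS]tlift_tens //; lin.
Qed.

Definition mul3 (t : tensor (tensor A A) A) : A :=
  \swd_(y ⊗ d <- t) \swd_(a ⊗ b <- y) yamul (yamul a b) d.

Lemma mul3_linear : linear mul3.
Proof. by rewrite /mul3; lin. Qed.

HB.instance Definition _ := GRing.isLinear.Build k _ _ *:%R mul3 mul3_linear.

Lemma mul3_tens a b d : mul3 (a ⊗ b ⊗ d) = yamul (yamul a b) d.
Proof. by rewrite /mul3 tlift_tens ?tlift_tens //; lin. Qed.

(** On [a ⊗ b ⊗ d] this is the untwisted bracket of [a] with the product of [b] and [d], as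
    [jacobi_half_tens] shows. *)
Definition jacobi_half (t : tensor (tensor A A) A) : A :=
  mul3 t - mul3 (C2 (C1 t)).

Lemma jacobi_half_linear : linear jacobi_half.
Proof. by rewrite /jacobi_half; lin. Qed.

HB.instance Definition _ :=
  GRing.isLinear.Build k _ _ *:%R jacobi_half jacobi_half_linear.

(** Naturality of the braiding carries [a] past the product of [b] and [d] one factor at a time,
    which is [C2 C1]; associativity identifies the remaining term with the triple product. *)
Lemma jacobi_half_tens a b d :
  haut A (jacobi_half (a ⊗ b ⊗ d)) = yd_bracket a (yamul b d).
Proof.
have -> : yd_bracket a (yamul b d) = br (a ⊗ yamul b d).
  by rewrite /= [RHS]tlift_tens //; lin.
rewrite bracketE braid_tens -(cbraid_natural_mul hA);
  last by move=> h; apply: uact_yamul.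
rewrite /jacobi_half braidl_tens mul3_tens linearB /= -yamul_assoc.
congr (_ - _).
  by rewrite /yamul hautVK [RHS]tlift_tens //; lin.
rewrite (linear_tlift (L := fun z => haut A (mul3 (C2 z)))); last by lin.
rewrite (linear_tlift (L := m)); last by lin.
apply: eq_tlift => y x; rewrite braidr_tens.
rewrite (linear_tlift (L := fun z => haut A (mul3 z))); last by lin.
rewrite (linear_tlift (L := m)); last by lin.
apply: eq_tlift => z w; rewrite mul3_tens [RHS]tlift_tens; last by lin.
by rewrite [in LHS]/yamul hautVK.
Qed.

(* With [s = C2 C1] the summand is [mul3 (1 - s)], and [s] has order 3. *)
Lemma jacobi_half_cyclic t :
  jacobi_half t + jacobi_half (C1 (C2 t)) + jacobi_half (C2 (C1 t)) = 0.
Proof.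
rewrite /jacobi_half braidlK braidrK braid_yang_baxter braidlK.
set p := mul3 t; set q := mul3 (C2 _); set r := mul3 (C1 _).
by rewrite -addrA [r - p + _]addrC subrKA addrA subrK subrr.
Qed.

Lemma haut_bracket a b :
  haut A (yd_bracket a b) = yd_bracket (haut A a) (haut A b).
Proof.
have := ydm_aut bracket_morphism (a ⊗ b).
by rewrite /= tmapE /tlin !tlift_tens //; lin.
Qed.

(** The inner bracket is [β] of an untwisted product taken on [1 - C], and the outer bracket
    commutes with [β]. One [β] comes out of the bracket and the other from [jacobi_half_tens]. *)
Lemma curlyE t : curly (yd_bracket (A := A)) t
  = haut A (haut A (jacobi_half t - jacobi_half (C2 t))).
Proof.
move: t; apply: tensor3_ext => [||a b d].
- by rewrite /curly; lin.
- by lin.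
rewrite /curly tlift_tens ?tlift_tens; try by lin.
rewrite /=.
have /= -> : yd_bracket b d
    = haut A (yamul b d - \swd_(y ⊗ x <- c b d) yamul y x).
  transitivity (br (b ⊗ d)); first by rewrite [RHS]tlift_tens //; lin.
  rewrite bracketE braid_tens linearB /=; congr (_ - _).
    by rewrite /yamul hautVK [LHS]tlift_tens //; lin.
  rewrite (linear_tlift (L := haut A)); last by lin.
  by apply: eq_tlift => y x; rewrite /yamul hautVK.
rewrite -haut_bracket; congr (haut A _).
rewrite linearBr [X in X - _]/= -jacobi_half_tens braidr_tens [RHS]linearB.
congr (_ - _).
rewrite [LHS]/= (linear_tlift (L := yd_bracket a)); last by lin.
rewrite (linear_tlift (L := fun z => haut A (jacobi_half z))); last by lin.
by apply: eq_tlift => y x; rewrite jacobi_half_tens.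
Qed.

Lemma bracket_hom_lie : is_braided_hom_lie (L := A) (yd_bracket (A := A)).
Proof.
split; first exact: bracket_morphism.
- move=> a b.
  rewrite -[LHS](tlift_tens (f := yd_bracket (A := A))); last by lin.
  (* Writing the argument of [m] as [C (C x)] turns [m x - m (C x)] into minus the bracket of
     [C x]. *)
  rewrite -[LHS]/(br _) bracketE -opprB -{2}(braidK (a ⊗ b)) -bracketE.
  rewrite {1}/braid tlift_tens; last by lin.
  rewrite (linear_tlift (L := br)); last by lin.
  by congr (- _); apply: eq_tlift => a1 a0; rewrite /tlin tlift_tens //; lin.
- move=> a b d; rewrite !curlyE -!linearD /=.
  have E (x y z x' y' z' : A) :
      x - x' + (y - y') + (z - z') = x + y + z - (x' + y' + z').
    by rewrite !opprD [x - x' + _]addrACA [LHS]addrACA.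
  (* The positive terms form the cyclic sum at [t]. In the others [C2] turns the orbit of [t] into
     that of [C2 t], run through in the opposite direction; hence the exchange of the last two
     terms. *)
  rewrite E jacobi_half_cyclic addrAC braidrK.
  have := jacobi_half_cyclic (C2 (a ⊗ b ⊗ d)); rewrite braidrK => ->.
  by rewrite subr0 !linear0.
Qed.

End Symmetric.
End Bracket.

Theorem proposition2p2 (k : fieldType) (H : homHopf k)
    (SV : H -> H) (SK : cancel (hanti H) SV) (SVK : cancel SV (hanti H))
    (A : ydAlgebra H) (symA : braiding_symmetric_on SV A) :
  is_braided_hom_lie (L := A) (yd_bracket (A := A)).
Proof. exact: bracket_hom_lie SK SVK symA. Qed.
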